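(* For any $\mathbb{Z}$ subshift $X$, the limiting entropy of $X$ is equal to the independence entropy of $X$, i.e. $h_{\infty}(X) = h_{\mathrm{ind}}(X)$.
   Context: Let $\Sigma$ be a finite set (alphabet). For $d\in\mathbb{N}$, a $\mathbb{Z}^d$ subshift is a closed (product topology) subset of $\Sigma^{\mathbb{Z}^d}$ invariant under all shifts $(\sigma_v x)_g = x_{g+v}$, $v\in\mathbb{Z}^d$. For a finite $S\subset\mathbb{Z}^d$ and a $\mathbb{Z}^d$ subshift $Y$, $\mathcal{L}(Y,S)=\{y_S : y\in Y\}$ is the set of configurations of shape $S$ appearing in points of $Y$. Let $F_n=F_n^{(d)}=[-n,n]^d\subset\mathbb{Z}^d$. The topological entropy of $Y$ is $h(Y)=\lim_{n\to\infty}\frac{1}{|F_n|}\log|\mathcal{L}(Y,F_n)|$. For a $\mathbb{Z}$ subshift $X\subset\Sigma^{\mathbb{Z}}$, its $d$th axial power is the $\mathbb{Z}^d$ subshift $$X^{\otimes d}=\{x\in\Sigma^{\mathbb{Z}^d} : \forall g\in\mathbb{Z}^d\ \forall i\in\{1,\dots,d\},\ x_{g+\mathbb{Z}e_i}\in X\},$$ where $x_{g+\mathbb{Z}e_i}\in\Sigma^{\mathbb{Z}}$ is the sequence $m\mapsto x_{g+me_i}$. The limiting entropy of $X$ is $h_\infty(X)=\lim_{d\to\infty}h(X^{\otimes d})$ (the sequence is nonincreasing in $d$, so the limit exists). Let $\hat\Sigma$ be the set of nonempty subsets of $\Sigma$. The multi-choice shift of $X$ is $\widehat{X}=\{\hat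 x\in\hat\Sigma^{\mathbb{Z}} : \prod_{n\in\mathbb{Z}}\hat x_n\subset X\}$. The independence score of a configuration $\hat w\in\hat\Sigma^F$ ($F$ finite) is $S(\hat w)=\frac{1}{|F|}\sum_{n\in F}\log|\hat w_n|$. The independence entropy of $X$ is $$h_{\mathrm{ind}}(X)=\lim_{n\to\infty}\sup\{S(\hat w) : \hat w\in\mathcal{L}(\widehat{X},F_n)\},\qquad F_n=[-n,n]\subset\mathbb{Z}.$$ *)

(* Defs.v *)
From HB Require Import structures.
From mathcomp Require Import all_boot all_order all_algebra finmap.
From mathcomp Require Import all_classical all_reals all_analysis.
From mathcomp Require Import zify.

Set Implicit Arguments.
Unset Strict Implicit.
Unset Printing Implicit Defensive.

Import Order.TTheory GRing.Theory Num.Theory.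
Import numFieldNormedType.Exports.

Local Open Scope classical_set_scope.
Local Open Scope ring_scope.

Section Subshifts.
Variables (G : zmodType) (A : finType).

Definition shift_by (v : G) (x : G -> A) : G -> A := fun g => x (g + v).

Definition subshift (X : set (G -> A)) : Prop :=
  closed (X : set (prod_topology (fun _ : G => discrete_topology A))) /\
  forall v x, X x -> X (shift_by v x).

Definition restriction (S : {fset G}) (x : G -> A) : {ffun S -> A} :=
  [ffun s => x (val s)].

Definition language (Y : set (G -> A)) (S : {fset G}) : set {ffun S -> A} :=
  [set restriction S y | y in Y].

End Subshifts.
Arguments language {G A} Y S.

Definition int_window_set (n : nat) : set int := [set k | `|k| <= n%:Z].

Definition box_set (d n : nat) : set 'rV[int]_d :=
  [set v | forall i, `|v 0 i| <= n%:Z].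
Arguments box_set : clear implicits.

Lemma finite_box (d n : nat) : finite_set (box_set d n).
Proof.
pose f (w : {ffun 'I_d -> 'I_(n + n).+1}) : 'rV[int]_d :=
  \row_i ((w i)%:Z - n%:Z).
apply: (@sub_finite_set _ _ (f @` setT)); last exact: finite_image.
move=> v vn; exists [ffun i => inord (absz (v ord0 i + n%:Z))] => //.
apply/rowP => i; rewrite mxE ffunE; have /= vin := vn i.
move: (v ord0 i) vin => k vin.
by rewrite inordK; lia.
Qed.

Lemma finite_int_window (n : nat) : finite_set (int_window_set n).
Proof.
pose f (i : 'I_(n + n).+1) : int := i%:Z - n%:Z.
apply: (@sub_finite_set _ _ (f @` setT)); last exact: finite_image.
move=> k; rewrite /int_window_set /= => kn; exists (inord (absz (k + n%:Z))) => //.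
by rewrite /f inordK; lia.
Qed.

(* [fset_set] returns [fset0] on infinite sets, hence the two lemmas above. *)
Definition int_window (n : nat) : {fset int} := fset_set (int_window_set n).

Definition box (d n : nat) : {fset 'rV[int]_d} := fset_set (box_set d n).

Section Entropy.
Variables (R : realType) (A : finType).

(* Entropies are extended reals, with [lne 0 = -oo] and [ereal_sup set0 = -oo],
   so that the empty subshift has entropy -oo. *)
Definition entropy (d : nat) (Y : set ('rV[int]_d -> A)) : \bar R :=
  limn (fun n => (#|` box d n|%:R^-1)%:E *
                 lne ((#|` fset_set (language Y (box d n))|)%:R%:E))%E.

Definition axial_power (X : set (int -> A)) (d : nat) :
    set ('rV[int]_d -> A) :=
  [set x | forall (g : 'rV[int]_d) (i : 'I_d),
     X (fun m : int => x (g + m *: delta_mx 0 i))].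
Arguments axial_power : clear implicits.

Definition limiting_entropy (X : set (int -> A)) : \bar R :=
  limn (fun d => entropy (axial_power X d)).

Definition nonempty_subset : finType :=
  {B : {set A} | B != finset.set0}.

Definition multi_choice (X : set (int -> A)) : set (int -> nonempty_subset) :=
  [set xh : int -> nonempty_subset |
     forall x : int -> A, (forall n, x n \in val (xh n)) -> X x].

Definition independence_score (F : {fset int})
    (w : {ffun F -> nonempty_subset}) : R :=
  #|` F|%:R^-1 * \sum_(n : F) ln #|val (w n)|%:R.

Definition independence_entropy (X : set (int -> A)) : \bar R :=
  limn (fun n => ereal_sup [set (independence_score w)%:E |
                   w in language (multi_choice X) (int_window n)]).

End Entropy.
Arguments axial_power {A} X d _.

(* Main.v *)
(* Upper bound. Let Om be the patterns of X^{(x)d} on V = (F_q)^d, where q = 2N+1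
   is a large prime, with the uniform measure and its Shannon entropy H. Choose
   R in V minimizing sum_v H(x_v | x_R) + lam |R|; then R has small density, and
   enlarging R by a set of density at most m/q lowers sum_v H(x_v | x_R) by at
   most lam m/q per site. If d >= q^m, there are such sets that contain, for every
   site v, the m sites preceding v in some direction, this direction being uniform
   when the set is drawn at random. Hence, given x_R, the letters of a typical
   word of length m+1 along a coordinate line have small total correlation, and
   by Gibbs' inequality every word made of non-negligible letters does occur: the
   sets of non-negligible letters form a product contained in the language of X.
   So sum_v H(x_v | x_R) is at most the maximal independence score of such local
   products, which by compactness approaches h_ind(X) for long words.

   Lower bound. If xh is a multi-choice point, all choices y_v in xh_{v_1+...+v_d}
   lie in X^{(x)d}; averaging over the shifts of xh compares the score on a box
   with the score on a long interval. *)
Require Import Defs.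
From mathcomp Require Import all_boot all_order all_algebra perm.
From mathcomp Require Import all_classical all_reals all_analysis.
From mathcomp Require Import finmap zify ring lra.

Set Implicit Arguments.
Unset Strict Implicit.
Unset Printing Implicit Defensive.

Import Order.TTheory GRing.Theory Num.Theory.
Import numFieldNormedType.Exports.

Local Open Scope ring_scope.

(** * Entropy of the uniform measure on a finite set *)

Lemma ln_le_subr1 (R : realType) (x : R) : 0 < x -> ln x <= x - 1.
Proof.
move=> x0; have -> : x = 1 + (x - 1) by ring.
by rewrite (le_trans (le_ln1Dx _)) //; lra.
Qed.

Lemma ln_nat_ge0 (R : realType) (n : nat) : 0 <= ln n%:R :> R.
Proof.
case: n => [|n]; first by rewrite ln0.
by rewrite ln_ge0 // ler1n.
Qed.

Lemma ler_ln_nat (R : realType) (m n : nat) :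
  (m <= n)%N -> ln m%:R <= ln n%:R :> R.
Proof.
case: m => [|m] mn; first by rewrite ln0 ?ln_nat_ge0.
rewrite ler_ln ?ler_nat // posrE ltr0n //.
exact: leq_trans mn.
Qed.

Section Entropy.
Variables (R : realType) (T : finType).
Implicit Types (E : {set T}).

Definition fiber (B : finType) E (f : T -> B) (b : B) : {set T} :=
  [set x in E | f x == b].

(* All entropies below are those of the uniform measure on [E], multiplied by
   [#|E|]. *)
Definition ent (B : finType) E (f : T -> B) : R :=
  \sum_(x in E) (ln #|E|%:R - ln #|fiber E f (f x)|%:R).

Definition cent (B C : finType) E (f : T -> B) (g : T -> C) : R :=
  \sum_(x in E) (ln #|fiber E g (g x)|%:R
                 - ln #|fiber E (fun y => (f y, g y)) (f x, g x)|%:R).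

Lemma fiber_gt0 (B : finType) E (f : T -> B) x :
  x \in E -> 0 < #|fiber E f (f x)|%:R :> R.
Proof. by move=> xE; rewrite ltr0n; apply/card_gt0P; exists x; rewrite inE xE eqxx. Qed.

Lemma eq_fiber (B C : finType) E (f : T -> B) (g : T -> C) x :
  (forall y, (f y == f x) = (g y == g x)) -> fiber E f (f x) = fiber E g (g x).
Proof. by move=> fg; apply/setP => y; rewrite !inE fg. Qed.

Lemma sum_fiber (B : finType) E (f : T -> B) (F : B -> R) :
  \sum_(x in E) F (f x) / #|fiber E f (f x)|%:R = \sum_(b in f @: E) F b.
Proof.
rewrite (partition_big_imset f) /=; apply: eq_bigr => b /imsetP[x xE ->].
rewrite (eq_bigr (fun=> F (f x) / #|fiber E f (f x)|%:R)); last first.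
  by move=> y /andP[_ /eqP ->].
rewrite sumr_const; have -> : #|[pred i in E | f i == f x]| = #|fiber E f (f x)|.
  by apply: eq_card => y; rewrite !inE.
by rewrite -[LHS]mulr_natr -mulrA mulVf ?mulr1 // gt_eqF // fiber_gt0.
Qed.

Lemma sum_card_fiber (B : finType) E (f : T -> B) :
  (\sum_b #|fiber E f b| = #|E|)%N.
Proof.
rewrite -sum1_card (partition_big f xpredT) //=; apply: eq_bigr => b _.
by rewrite -sum1_card; apply: eq_bigl => x; rewrite !inE.
Qed.

Lemma sum_card_fiber_pair (B C : finType) E (f : T -> B) (g : T -> C) c :
  (\sum_b #|fiber E (fun y => (f y, g y)) (b, c)| = #|fiber E g c|)%N.
Proof.
rewrite -(sum_card_fiber (fiber E g c) f); apply: eq_bigr => b _.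
apply: eq_card => x; rewrite !inE xpair_eqE.
by rewrite -andbA [(f x == b) && _]andbC.
Qed.

(** Gibbs' inequality: [ln t <= t - 1] is applied to the ratio of the kernel [Q] to the true
    conditional frequency of [f x] given [g x]. A mass bound [m] below [1] yields a gain, which
    [total_correlation_ge] exploits. *)
Lemma cent_le_gibbs (B C : finType) E (f : T -> B) (g : T -> C)
    (Q : C -> B -> R) (m : R) :
  (forall c b, 0 <= Q c b) -> (forall x, x \in E -> 0 < Q (g x) (f x)) ->
  (forall c, \sum_b Q c b <= m) ->
  cent E f g <= \sum_(x in E) - ln (Q (g x) (f x)) + (m - 1) * #|E|%:R.
Proof.
move=> Q0 Qp Qm.
set k := fun y => (f y, g y).
rewrite -lerBlDl -sumrB.
apply: (@le_trans _ _ (\sum_(x in E) (#|fiber E g (g x)|%:R * Q (g x) (f x)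
    / #|fiber E k (k x)|%:R - 1))).
  apply: ler_sum => x xE; rewrite opprK.
  have p1 := fiber_gt0 g xE; have p2 := fiber_gt0 k xE; have p3 := Qp _ xE.
  apply: le_trans (ln_le_subr1 _); last by rewrite divr_gt0 ?mulr_gt0.
  rewrite ln_div ?posrE ?mulr_gt0 // lnM ?posrE // /k; lra.
rewrite sumrB sumr_const mulrBl mul1r lerD2r.
(* From here each value of the pair [(f, g)] counts once, so the mass bound on [Q] can be summed
   over all pairs. *)
rewrite (sum_fiber E k (fun p => #|fiber E g p.2|%:R * Q p.2 p.1)).
apply: (@le_trans _ _ (\sum_p (#|fiber E g p.2|%:R * Q p.2 p.1))).
  rewrite [leRHS](bigID [in k @: E]) /= lerDl sumr_ge0 // => p _.
  by rewrite mulr_ge0.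
rewrite -(pair_bigA _ (fun b c => #|fiber E g c|%:R * Q c b)) /=.
rewrite exchange_big /= -(sum_card_fiber E g) natr_sum mulr_sumr.
apply: ler_sum => c _; rewrite -mulr_sumr mulrC.
by rewrite ler_wpM2r.
Qed.

Lemma cent_ge0 (B C : finType) E (f : T -> B) (g : T -> C) : 0 <= cent E f g.
Proof.
apply: sumr_ge0 => x xE; rewrite subr_ge0 ler_ln_nat //.
apply: subset_leq_card; apply/fintype.subsetP => y.
by rewrite !inE xpair_eqE => /and3P[-> _ ->].
Qed.

(** Gibbs' inequality against the uniform law on [B]. *)
Lemma cent_le_card (B C : finType) E (f : T -> B) (g : T -> C) :
  cent E f g <= #|E|%:R * ln #|B|%:R.
Proof.
have [->|/set0Pn[x0 x0E]] := eqVneq E finset.set0.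
  by rewrite /cent big_set0 cards0 mul0r.
have B0 : 0 < #|B|%:R :> R by rewrite ltr0n; apply/card_gt0P; exists (f x0).
apply: le_trans (@cent_le_gibbs B C E f g (fun _ _ => #|B|%:R^-1) 1 _ _ _) _.
- by move=> *; rewrite invr_ge0.
- by move=> *; rewrite invr_gt0.
- by move=> c; rewrite sumr_const -[_ *+ _]mulr_natr mulVf // gt_eqF.
- rewrite subrr mul0r addr0 sumr_const lnV ?posrE // opprK -[_ *+ _]mulr_natr.
  by rewrite mulrC.
Qed.

(** Gibbs' inequality against the law of [f] given the coarser variable [g], read as a kernel on the
    values of [h]. *)
Lemma cent_mono (B C D : finType) E (f : T -> B) (g : T -> C) (h : T -> D)
    (k : D -> C) :
  (forall x, g x = k (h x)) -> cent E f h <= cent E f g.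
Proof.
move=> gk.
pose Q c b : R := #|fiber E (fun y => (f y, g y)) (b, k c)|%:R
  / #|fiber E g (k c)|%:R.
apply: le_trans (@cent_le_gibbs B D E f h Q 1 _ _ _) _.
- by move=> *; rewrite divr_ge0.
- by move=> x xE; rewrite /Q -gk divr_gt0 ?fiber_gt0 ?(fiber_gt0 (fun y => (f y, g y))).
- move=> c; rewrite /Q -mulr_suml -natr_sum sum_card_fiber_pair.
  (* If the fiber is empty, division by [0] gives mass [0]. *)
  have [->|n0] := eqVneq #|fiber E g (k c)| 0%N; first by rewrite mul0r.
  by rewrite divff // pnatr_eq0.
- rewrite subrr mul0r addr0 /cent; apply: ler_sum => x xE.
  rewrite /Q -gk ln_div ?posrE ?fiber_gt0 ?(fiber_gt0 (fun y => (f y, g y))) //.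
  by rewrite opprB.
Qed.

Lemma cent_partition (B C : finType) E (f : T -> B) (g : T -> C) :
  cent E f g = \sum_(c in g @: E) ent (fiber E g c) f.
Proof.
rewrite /cent (partition_big_imset g) /=; apply: eq_bigr => c _.
rewrite /ent; apply: eq_big => [x|x /andP[xE /eqP gx]]; first by rewrite !inE.
rewrite gx; congr (_ - ln #|pred_of_set _|%:R).
by apply/setP => y; rewrite !inE xpair_eqE -andbA [(_ == c) && _]andbC.
Qed.

Lemma ent_cent (B : finType) E (f : T -> B) : ent E f = cent E f (fun=> tt).
Proof.
have fE : fiber E (fun=> tt) tt = E by apply/setP => y; rewrite !inE eqxx andbT.
apply: eq_bigr => x xE; rewrite fE; congr (_ - ln #|pred_of_set _|%:R).
by apply/setP => y; rewrite !inE xpair_eqE eqxx andbT.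
Qed.

End Entropy.

(** * Entropies of letters and of words *)

Lemma ln_prod (R : realType) (I : finType) (F : I -> R) :
  (forall i, 0 < F i) -> ln (\prod_i F i) = \sum_i ln (F i).
Proof.
move=> F0; pose P (x y : R) := 0 < x /\ ln x = y.
suff [] : P (\prod_i F i) (\sum_i ln (F i)) by [].
apply: (big_ind2 P); rewrite /P; first by rewrite ln1.
- by move=> x1 x2 y1 y2 [p1 <-] [p2 <-]; rewrite mulr_gt0 // lnM.
- by move=> i _.
Qed.

(** Gibbs' inequality against a law that spreads weight [1 / (1 + eta)] evenly over [B] and gives
    each other letter [eta / ((1 + eta) #|A|)]. A letter outside [B] costs the logarithm [K], but
    occurs with frequency at most [delta]. An empty [B] is covered, as [ln 0 = 0]. *)
Lemma ent_le_support (R : realType) (T A : finType) (E : {set T}) (f : T -> A)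
    (B : {set A}) (eta delta : R) :
  0 < eta -> 0 <= delta ->
  (forall a, a \notin B -> #|fiber E f a|%:R <= delta * #|E|%:R) ->
  ent R E f <= #|E|%:R *
    (ln #|B|%:R + eta + #|A|%:R * delta * ln ((1 + eta) * #|A|%:R / eta)).
Proof.
move=> eta0 delta0 fB; set K := ln (_ / eta).
have [->|/set0Pn[x0 x0E]] := eqVneq E finset.set0.
  by rewrite /ent big_set0 cards0 mul0r.
have A1 : 1 <= #|A|%:R :> R by rewrite ler1n; apply/card_gt0P; exists (f x0).
have K0 : 0 <= K.
  by rewrite /K ln_ge0 // ler_pdivlMr // mul1r; nra.
pose Q (_ : unit) (a : A) : R :=
  if a \in B then ((1 + eta) * #|B|%:R)^-1 else eta / ((1 + eta) * #|A|%:R).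
have e1 : 0 < 1 + eta by lra.
have B0 a : a \in B -> 0 < #|B|%:R :> R.
  by move=> aB; rewrite ltr0n; apply/card_gt0P; exists a.
have Q0 c a : 0 < Q c a.
  rewrite /Q; case: ifPn => aB; first by rewrite invr_gt0 mulr_gt0 ?(B0 a).
  by rewrite divr_gt0 // mulr_gt0 //; lra.
rewrite ent_cent; apply: le_trans (@cent_le_gibbs R T A unit E f _ Q 1 _ _ _) _ => //.
- by move=> c b; rewrite ltW.
- move=> c; rewrite (bigID [in B]) /= /Q.
  rewrite (eq_bigr (fun=> ((1 + eta) * #|B|%:R)^-1)); last by move=> a ->.
  rewrite [X in _ + X](eq_bigr (fun=> eta / ((1 + eta) * #|A|%:R))); last first.
    by move=> a /negbTE ->.
  rewrite !sumr_const -[X in X + _]mulr_natr -[X in _ + X]mulr_natr.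
  have l1 : ((1 + eta) * #|B|%:R)^-1 * #|B|%:R <= (1 + eta)^-1 :> R.
    have [->|] := eqVneq #|B| 0%N; first by rewrite !mulr0 invr_ge0 ltW.
    rewrite -(pnatr_eq0 R) => B1.
    by rewrite invfM -mulrA mulVf // mulr1.
  have l2 : eta / ((1 + eta) * #|A|%:R) * #|[predC B]|%:R <= eta / (1 + eta).
    rewrite invfM mulrA -mulrA; apply: ler_piMr.
      by rewrite divr_ge0 // ltW.
    by rewrite ler_pdivrMl ?mulr1 ?ler_nat ?max_card //; lra.
  apply: le_trans (lerD l1 l2) _.
  by rewrite -[X in X + _]mul1r -mulrDl divff // gt_eqF.
rewrite subrr mul0r addr0.
apply: (@le_trans _ _ (\sum_(x in E) (ln #|B|%:R + eta + (f x \notin B)%:R * K))).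
  apply: ler_sum => x xE; rewrite /Q; case: ifPn => fxB /=.
    rewrite mul0r addr0 lnV ?posrE ?mulr_gt0 ?(B0 (f x)) // opprK.
    rewrite lnM ?posrE ?(B0 (f x)) // addrC lerD2l.
    by apply: le_trans (ln_le_subr1 _) _ => //; lra.
  rewrite mul1r -lnV ?posrE ?divr_gt0 ?mulr_gt0 //; last by lra.
  rewrite invf_div -/K lerDr addr_ge0 ?ln_nat_ge0 ?ltW //.
rewrite big_split /= sumr_const -mulr_suml -[_ *+ #|E|]mulr_natl [leRHS]mulrDr lerD2l.
rewrite mulrA ler_wpM2r // mulrC.
rewrite -natr_sum (partition_big f xpredT) //= natr_sum.
apply: (@le_trans _ _ (\sum_(a : A) delta * #|E|%:R)).
  apply: ler_sum => a _; have [aB|aB] := boolP (a \in B).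
    rewrite big1 ?mulr_ge0 // => x /andP[_ /eqP ->]; by rewrite aB.
  apply: le_trans (fB a aB); rewrite ler_nat.
  rewrite (eq_bigr (fun=> 1%N)); last by move=> x /andP[_ /eqP ->]; rewrite aB.
  by rewrite sum1dep_card; apply: subset_leq_card; apply/fintype.subsetP => x; rewrite !inE.
by rewrite sumr_const -[_ *+ _]mulr_natl mulrA.
Qed.

(* Gibbs' inequality against the product of the marginals, with the words of [S]
   removed: words that never occur cost their product probability. *)
Lemma total_correlation_ge (R : realType) (T A : finType) (n : nat)
    (E : {set T}) (f : 'I_n -> T -> A) (S : {set {ffun 'I_n -> A}}) :
  (forall x, x \in E -> [ffun k => f k x] \notin S) ->
  #|E|%:R * \sum_(w in S) \prod_k (#|fiber E (f k) (w k)|%:R / #|E|%:R) <=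
  \sum_k ent R E (f k) - ent R E (fun x => [ffun k => f k x]).
Proof.
move=> fS.
have [->|/set0Pn[x0 x0E]] := eqVneq E finset.set0.
  rewrite cards0 mul0r /ent big_set0 subr0 sumr_ge0 // => k _.
  by rewrite big_set0.
have E0 : 0 < #|E|%:R :> R by rewrite ltr0n; apply/card_gt0P; exists x0.
pose p k a : R := #|fiber E (f k) a|%:R / #|E|%:R.
pose Q (_ : unit) (v : {ffun 'I_n -> A}) : R :=
  if v \in S then 0 else \prod_k p k (v k).
have p0 k x : x \in E -> 0 < p k (f k x).
  by move=> xE; rewrite divr_gt0 // (fiber_gt0 R (f k)).
have Qf x : x \in E -> Q tt [ffun k => f k x] = \prod_k p k (f k x).
  by move=> xE; rewrite /Q (negbTE (fS x xE)); apply: eq_bigr => k _; rewrite ffunE.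
have := @cent_le_gibbs R T _ unit E (fun x => [ffun k => f k x]) (fun=> tt) Q
  (1 - \sum_(w in S) \prod_k p k (w k)).
rewrite -ent_cent => /(_ _ _ _)/wrap[].
- move=> c v; rewrite /Q; case: ifP => // _.
  by rewrite prodr_ge0 // => k _; rewrite divr_ge0.
- by move=> x xE; rewrite Qf // prodr_gt0 // => k _; apply: p0.
- move=> c; rewrite (bigID [in S]) /= big1; last by move=> v vS; rewrite /Q vS.
  rewrite add0r lerBrDr.
  rewrite (eq_bigr (fun v : {ffun 'I_n -> A} => \prod_k p k (v k))); last first.
    by move=> v /negbTE vS; rewrite /Q vS.
  rewrite [leLHS](_ : _ = \sum_(v : {ffun 'I_n -> A}) \prod_k p k (v k)); last first.
    by rewrite [RHS](bigID [in S]) addrC.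
  rewrite -(bigA_distr_bigA p) /=.
  rewrite big1 // => k _; rewrite -mulr_suml -natr_sum sum_card_fiber.
  by rewrite divff // gt_eqF.
have -> : \sum_(x in E) - ln (Q tt [ffun k => f k x]) = \sum_k ent R E (f k).
  rewrite exchange_big /=; apply: eq_bigr => x xE.
  rewrite Qf // ln_prod; last by move=> k; apply: p0.
  rewrite -sumrN; apply: eq_bigr => k _.
  by rewrite ln_div ?opprB // posrE // (fiber_gt0 R (f k)).
rewrite addrAC subrr add0r mulNr => h; rewrite lerBrDr addrC -lerBrDr.
by apply: le_trans h _; rewrite mulrC.
Qed.

(** Let [W k] be the set of letters of frequency at least [delta] at position [k]. If all words over
    [W] satisfy [L], the assumption on products bounds the entropies up to the cost of rare letters.
    Otherwise a missing word has product probability at least [delta ^+ n], which forces a large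
    total correlation. It matters that [C] depends on [A], [n] and [eps] only. *)
Lemma sum_ent_le_word (R : realType) (A : finType) (n : nat) (eps : R) :
  0 < eps -> exists2 C : R, 0 <= C &
  forall (T : finType) (E : {set T}) (f : 'I_n -> T -> A)
      (L : pred {ffun 'I_n -> A}) (b : R),
    0 <= b ->
    (forall x, x \in E -> L [ffun k => f k x]) ->
    (forall W : 'I_n -> {set A}, (forall k, W k != finset.set0) ->
       (forall w : {ffun 'I_n -> A}, (forall k, w k \in W k) -> L w) ->
       \sum_k ln #|W k|%:R <= b) ->
    \sum_k ent R E (f k) <= #|E|%:R * (b + n%:R * eps) +
      C * (\sum_k ent R E (f k) - ent R E (fun x => [ffun k => f k x])).
Proof.
move=> eps0.
pose eta := eps / 2; pose K : R := ln ((1 + eta) * #|A|%:R / eta).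
pose N : R := #|A|.+1%:R.
(* The first bound makes [#|A| * delta < 1], so that every [W k] is nonempty; the second keeps the
   cost of rare letters below [eps / 2]. *)
pose delta : R := Num.min N^-1 (eps / 2 / (N * (`|K| + 1))).
have N0 : 0 < N by rewrite ltr0n.
have K1 : 0 < `|K| + 1 by rewrite ltr_wpDl.
have delta0 : 0 < delta.
  by rewrite lt_min invr_gt0 N0 !divr_gt0 // mulr_gt0.
have eta0 : 0 < eta by rewrite divr_gt0.
have AN : #|A|%:R <= N by rewrite ler_nat.
have small : #|A|%:R * delta * K <= eps / 2.
  apply: (@le_trans _ _ (N * delta * (`|K| + 1))).
    apply: (@le_trans _ _ (#|A|%:R * delta * (`|K| + 1))).
      rewrite ler_wpM2l ?mulr_ge0 ?(ltW delta0) //.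
      by rewrite (le_trans (ler_norm K)) // lerDl.
    by rewrite ler_wpM2r ?(ltW K1) // ler_wpM2r // ltW.
  rewrite mulrAC mulrC -ler_pdivlMr ?mulr_gt0 //.
  by rewrite /delta ge_min lexx orbT.
(* Chosen so that [C * delta ^+ n] is the trivial bound [n ln #|A|]. *)
pose C : R := n%:R * ln #|A|%:R / delta ^+ n.
exists C; first by rewrite divr_ge0 ?mulr_ge0 ?ln_nat_ge0 ?exprn_ge0 ?(ltW delta0).
move=> T E f L b b0 fL Lb.
have [->|/set0Pn[x0 x0E]] := eqVneq E finset.set0.
  rewrite /ent big1; last by move=> k _; rewrite big_set0.
  by rewrite big_set0 cards0 mul0r !subr0 mulr0 addr0.
have E0 : 0 < #|E|%:R :> R by rewrite ltr0n; apply/card_gt0P; exists x0.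
pose W k := [set a | delta * #|E|%:R <= #|fiber E (f k) a|%:R].
have entW k : ent R E (f k) <= #|E|%:R * (ln #|W k|%:R + eps).
  apply: le_trans (@ent_le_support R T A E (f k) (W k) eta delta eta0 (ltW delta0) _) _.
    by move=> a; rewrite inE -ltNge => /ltW.
  rewrite ler_wpM2l // -addrA lerD2l -/K; rewrite /eta in small *; lra.
(* First case: some word of frequent letters fails [L], hence never occurs. *)
have [/existsP[w]|/existsPn noW] := boolP [exists w : {ffun 'I_n -> A},
    [forall k, w k \in W k] && ~~ L w].
  move=> /andP[/forallP wW Lw].
  have := @total_correlation_ge R T A n E f [set w]%SET => /(_ _)/wrap[].
    by move=> x xE; rewrite finset.in_set1; apply: contraNneq Lw => <-; apply: fL.
  rewrite big_set1.
  set t := (X in _ <= X) => ht.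
  have dt : delta ^+ n * #|E|%:R <= t.
    apply: le_trans ht; rewrite mulrC ler_wpM2l //.
    rewrite -[X in delta ^+ X]card_ord -prodr_const.
    apply: ler_prod => k _; rewrite (ltW delta0) ler_pdivlMr //.
    by have := wW k; rewrite inE.
  apply: (@le_trans _ _ (C * t)); last first.
    by rewrite lerDr mulr_ge0 // addr_ge0 // mulr_ge0 // (ltW eps0).
  apply: (@le_trans _ _ (n%:R * ln #|A|%:R * #|E|%:R)).
    rewrite -mulrA mulr_natl -[X in _ *+ X]card_ord -sumr_const.
    by apply: ler_sum => k _; rewrite ent_cent mulrC cent_le_card.
  rewrite /C -[leRHS]mulrA ler_wpM2l ?mulr_ge0 ?ln_nat_ge0 //.
  by rewrite ler_pdivlMl ?exprn_gt0.
have t0 : 0 <= \sum_k ent R E (f k) - ent R E (fun x => [ffun k => f k x]).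
  have := @total_correlation_ge R T A n E f finset.set0 => /(_ _)/wrap[].
    by move=> x _; rewrite finset.in_set0.
  by rewrite big_set0 mulr0.
apply: (@le_trans _ _ (#|E|%:R * (b + n%:R * eps))); last first.
  by rewrite lerDl mulr_ge0 // divr_ge0 ?mulr_ge0 ?ln_nat_ge0 ?exprn_ge0 ?(ltW delta0).
apply: (@le_trans _ _ (\sum_k #|E|%:R * (ln #|W k|%:R + eps))).
  by apply: ler_sum => k _; apply: entW.
rewrite -mulr_sumr ler_wpM2l // big_split /= sumr_const card_ord mulr_natl lerD2r.
apply: Lb => [k|w wW].
  apply/eqP => W0.
  (* If [W k] were empty, all letter frequencies would be below [delta] and could not add up to
     [1]. *)
  have : #|E|%:R <= #|A|%:R * (delta * #|E|%:R).
    rewrite -{1}(sum_card_fiber E (f k)) natr_sum mulr_natl -sumr_const.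
    apply: ler_sum => a _; rewrite ltW // ltNge.
    by have := finset.in_set0 a; rewrite -W0 inE => ->.
  rewrite mulrA -{1}[#|E|%:R]mul1r ler_pM2r //; apply/negP; rewrite -ltNge.
  apply: (@le_lt_trans _ _ (#|A|%:R * N^-1)).
    by rewrite ler_wpM2l // ge_min lexx.
  by rewrite ltr_pdivrMr // mul1r ltr_nat.
have := noW w; rewrite negb_and negbK => /orP[/forallPn[k]|//].
by rewrite wW.
Qed.

(** * Entropy of configurations *)

Section Configurations.
Variables (R : realType) (V A : finType) (Om : {set {ffun V -> A}}).
Implicit Types (S : {set V}) (v : V) (x : {ffun V -> A}).

(** The value [None] off [S] gives all restrictions one codomain, so that [S] can vary freely. *)
Definition proj S x : {ffun V -> option A} :=
  [ffun v => if v \in S then Some (x v) else None].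

Lemma projP S x y : proj S y = proj S x <-> {in S, y =1 x}.
Proof.
split=> [yx v vS|yx].
  by have /ffunP/(_ v) := yx; rewrite !ffunE vS => -[->].
by apply/ffunP => v; rewrite !ffunE; case: ifPn => // /yx ->.
Qed.

Definition site_ent v S : R := cent R Om (fun x => x v) (proj S).

(* Shifted so that the full set has entropy [0] and the empty set has entropy
   [- #|Om| ln #|Om|]. *)
Definition shifted_ent S : R := - \sum_(x in Om) ln #|fiber Om (proj S) (proj S x)|%:R.

Lemma site_ent_mono v S S' : S \subset S' -> site_ent v S' <= site_ent v S.
Proof.
move=> /fintype.subsetP SS'.
apply: (@cent_mono R _ _ _ _ _ _ _ _ (fun r : {ffun V -> option A} =>
  [ffun u => if u \in S then r u else None])) => x.
apply/ffunP => u; rewrite !ffunE; case: ifP => // uS.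
by rewrite SS'.
Qed.

Lemma site_ent_ge0 v S : 0 <= site_ent v S.
Proof. exact: cent_ge0. Qed.

Lemma site_ent_le v S : site_ent v S <= #|Om|%:R * ln #|A|%:R.
Proof. exact: cent_le_card. Qed.

(** The chain rule: fixing [x v] and [x] on [S] amounts to fixing [x] on [v |: S]. *)
Lemma site_entE v S : site_ent v S = shifted_ent (v |: S) - shifted_ent S.
Proof.
rewrite /site_ent /shifted_ent opprK addrC -sumrB; apply: eq_bigr => x xE.
congr (_ - ln #|pred_of_set _|%:R).
apply: (@eq_fiber _ _ _ _ (fun y : {ffun V -> A} => (y v, proj S y)) (proj (v |: S))) => y.
apply/eqP/eqP => [[yxv /projP yx]|/projP yx].
  by apply/projP => u; rewrite in_setU1 => /orP[/eqP ->|/yx].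
congr pair; first by rewrite yx // setU11.
by apply/projP => u uS; apply: yx; rewrite in_setU1 uS orbT.
Qed.

Lemma shifted_ent0 : shifted_ent finset.set0 = - (#|Om|%:R * ln #|Om|%:R).
Proof.
rewrite /shifted_ent; congr (- _); rewrite mulr_natl -sumr_const.
apply: eq_bigr => x _; rewrite (_ : fiber _ _ _ = Om) //.
apply/setP => y; rewrite inE; case: (y \in Om) => //=.
by apply/eqP/projP => v; rewrite finset.in_set0.
Qed.

Lemma shifted_entT : shifted_ent finset.setT = 0.
Proof.
rewrite /shifted_ent big1 ?oppr0 // => x xE.
rewrite (_ : fiber _ _ _ = [set x]%SET) ?cards1 ?ln1 //.
apply/setP => y; rewrite !inE.
apply/andP/eqP => [[_ /eqP/projP yx]|->]; last by split => //; apply/eqP.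
by apply/ffunP => v; apply: yx; rewrite inE.
Qed.

(** The sites of [s] are added one by one; by monotonicity each increment is at most the site
    entropy given [S] alone. *)
Lemma shifted_ent_seq S (s : seq V) :
  shifted_ent (S :|: [set v in s]%SET) <= shifted_ent S + \sum_(v <- s) site_ent v S.
Proof.
elim: s => [|v s IH].
  rewrite big_nil addr0 (_ : [set v in [::]]%SET = finset.set0) ?finset.setU0 //.
rewrite big_cons (_ : S :|: _ = v |: (S :|: [set v in s]%SET)); last first.
  by apply/setP => u; rewrite !inE orbCA.
have := site_entE v (S :|: [set v in s]%SET).
have := @site_ent_mono v S (S :|: [set v in s]%SET) (finset.subsetUl _ _).
by lra.
Qed.

(** The chain rule from the empty set up to [S], where each site costs at most [ln #|A|], and then
    from [S] to the full set. *)
Lemma ln_card_le_site_ent S :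
  #|Om|%:R * ln #|Om|%:R <=
  #|S|%:R * (#|Om|%:R * ln #|A|%:R) + \sum_v site_ent v S.
Proof.
have := shifted_ent_seq finset.set0 (enum S); have := shifted_ent_seq S (enum V).
have -> : S :|: [set v in enum V]%SET = finset.setT.
  by apply/setP => v; rewrite !inE mem_enum orbT.
have -> : finset.set0 :|: [set v in enum S]%SET = S.
  by apply/setP => v; rewrite !inE mem_enum.
rewrite shifted_entT shifted_ent0 !big_enum /=.
have : \sum_(v in S) site_ent v finset.set0 <= #|S|%:R * (#|Om|%:R * ln #|A|%:R).
  by rewrite mulr_natl -sumr_const; apply: ler_sum => v _; apply: site_ent_le.
by lra.
Qed.

Lemma cent_wordE (n : nat) (j : nat -> V) S :
  cent R Om (fun x => [ffun k : 'I_n => x (j k)]) (proj S) =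
  shifted_ent (S :|: [set v in map j (iota 0 n)]%SET) - shifted_ent S.
Proof.
rewrite /shifted_ent opprK addrC -sumrB; apply: eq_bigr => x xE.
congr (_ - ln #|pred_of_set _|%:R).
set J := [set v in _]%SET.
apply: (@eq_fiber _ _ _ _ (fun y : {ffun V -> A} => ([ffun k : 'I_n => y (j k)], proj S y))
  (proj (S :|: J))) => y.
apply/eqP/eqP => [[/ffunP jj /projP yx]|/projP yx].
  apply/projP => u; rewrite !inE => /orP[/yx //|/mapP[k]].
  rewrite mem_iota add0n => /andP[_ kn] ->.
  by have := jj (Ordinal kn); rewrite !ffunE.
congr pair; last by apply/projP => u uS; apply: yx; rewrite inE uS.
apply/ffunP => k; rewrite !ffunE; apply: yx.
by rewrite !inE map_f ?orbT // mem_iota add0n ltn_ord.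
Qed.

(** The chain rule along the word: the letter at [j k] is conditioned on [S] and the earlier
    letters, all of which lie in [S :|: P k]. *)
Lemma cent_word_ge (n : nat) (j : nat -> V) S (P : nat -> {set V}) :
  (forall k i, (i < k < n)%N -> j i \in P k) ->
  \sum_(k < n) site_ent (j k) (S :|: P k) <=
  cent R Om (fun x => [ffun k : 'I_n => x (j k)]) (proj S).
Proof.
rewrite cent_wordE; elim: n => [|n IH] jP.
  rewrite big_ord0 (_ : [set v in _]%SET = finset.set0) ?finset.setU0 ?subrr //.
have -> : S :|: [set v in map j (iota 0 n.+1)]%SET =
    j n |: (S :|: [set v in map j (iota 0 n)]%SET).
  rewrite -[n.+1]addn1 iotaD map_cat; apply/setP => v.
  by rewrite !inE mem_cat /= add0n !inE orbA orbC.
rewrite big_ord_recr /=.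
have := IH (fun k i ikn => jP k i (let: conj ik kn := andP ikn in
  introT andP (conj ik (ltnW kn)))).
have : site_ent (j n) (S :|: P n) <= site_ent (j n) (S :|: [set v in map j (iota 0 n)]%SET).
  apply: site_ent_mono; apply: finset.setUS; apply/fintype.subsetP => v.
  rewrite inE => /mapP[i]; rewrite mem_iota add0n => /andP[_ ilt] ->.
  by rewrite jP // ilt ltnSn.
by rewrite (site_entE _ (_ :|: [set v in _]%SET)); lra.
Qed.

End Configurations.

(** [sum_ent_le_word] is applied on each fiber of the projection to [S], and the results are summed.
    By [cent_word_ge] the total correlation given [x] on [S] is at most the drop of the site
    entropies when [P k] joins the conditioning. *)
Lemma sum_site_ent_le_word (R : realType) (A : finType) (n : nat) (eps : R) :
  0 < eps -> exists2 C : R, 0 <= C &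
  forall (V : finType) (Om : {set {ffun V -> A}}) (S : {set V}) (j : nat -> V)
      (L : pred {ffun 'I_n -> A}) (b : R) (P : nat -> {set V}),
    0 <= b ->
    (forall x, x \in Om -> L [ffun k : 'I_n => x (j k)]) ->
    (forall W : 'I_n -> {set A}, (forall k, W k != finset.set0) ->
       (forall w : {ffun 'I_n -> A}, (forall k, w k \in W k) -> L w) ->
       \sum_k ln #|W k|%:R <= b) ->
    (forall k i, (i < k < n)%N -> j i \in P k) ->
    \sum_(k < n) site_ent R Om (j k) S <= #|Om|%:R * (b + n%:R * eps) +
      C * \sum_(k < n) (site_ent R Om (j k) S - site_ent R Om (j k) (S :|: P k)).
Proof.
move=> eps0; have [C C0 HC] := sum_ent_le_word A n eps0.
exists C => // V Om S j L b P b0 OmL Lb jP.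
apply: (@le_trans _ _ (#|Om|%:R * (b + n%:R * eps) + C * (\sum_(k < n) site_ent R Om (j k) S -
   cent R Om (fun x => [ffun k : 'I_n => x (j k)]) (proj S)))); last first.
  rewrite lerD2l ler_wpM2l // sumrB lerD2l lerN2; exact: cent_word_ge.
rewrite (eq_bigr _ (fun k _ => cent_partition R Om _ (proj S))) exchange_big /=.
rewrite (cent_partition R Om _ (proj S)) -sumrB mulr_sumr.
rewrite -(sum_card_fiber Om (proj S)).
have -> : (\sum_b0 #|fiber Om (proj S) b0| =
    \sum_(c in proj S @: Om) #|fiber Om (proj S) c|)%N.
  rewrite [LHS](bigID [in proj S @: Om]) /= [X in (_ + X)%N]big1 ?addn0 // => c cO.
  apply/eqP; rewrite cards_eq0; apply/eqP/setP => x; rewrite !inE.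
  by apply: contraNF cO => /andP[xO /eqP <-]; apply: imset_f.
rewrite natr_sum mulr_suml -big_split /=; apply: ler_sum => c _.
apply: (HC _ (fiber Om (proj S) c) (fun k x => x (j k)) L b) => // x.
by rewrite inE => /andP[xO _]; apply: OmL.
Qed.

(** * Sparse sets containing segments in all directions *)

(** Exchanging the values [s] and [t] at coordinate [i] is an involution, so all the fibers have the
    same size. *)
Lemma card_ffun_eq (I B : finType) (i : I) (t : B) :
  (#|[set v : {ffun I -> B} | v i == t]| * #|B| = #|{ffun I -> B}|)%N.
Proof.
have cst s : #|[set v : {ffun I -> B} | v i == s]| =
    #|[set v : {ffun I -> B} | v i == t]|.
  pose h (v : {ffun I -> B}) := [ffun j => if j == i then tperm s t (v j) else v j].
  have hK : involutive h.
    by move=> v; apply/ffunP => j; rewrite !ffunE; case: ifP => jE; rewrite ?jE ?tpermK.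
  rewrite -(card_imset _ (inv_inj hK)); apply: eq_card => v; rewrite !inE.
  apply/imsetP/eqP => [[w]|vt].
    by rewrite inE => /eqP ws ->; rewrite ffunE eqxx ws tpermL.
  by exists (h v); rewrite ?hK // inE ffunE eqxx vt tpermR.
rewrite -[RHS]cardsT -(sum_card_fiber finset.setT (fun v : {ffun I -> B} => v i)).
under eq_bigr => s _.
  rewrite (_ : #|_| = #|[set v : {ffun I -> B} | v i == t]|); last first.
    by rewrite -(cst s); apply: eq_card => v; rewrite !inE.
  over.
by rewrite sum_nat_const mulnC.
Qed.

(** * A random sparse set in the torus over a prime field *)

Section Directions.
Variables (q d m : nat) (q_prime : prime q) (m_lt_q : (m < q)%N).
Let V := {ffun 'I_d -> 'F_q}.
(** Elements of [G] play two roles: labels [g] of distinct coordinate directions, and random offsets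
    [c]. *)
Let G := {ffun 'I_m -> 'F_q}.
Variables (dir : G -> 'I_d) (dir_inj : injective dir).
Implicit Types (v u : V) (g c : G).

Definition move (i : 'I_d) (a : 'F_q) v : V :=
  [ffun j => v j + (if j == i then a else 0)].

Lemma moveD i a b v : move i a (move i b v) = move i (a + b) v.
Proof.
by apply/ffunP => j; rewrite !ffunE; case: ifP => _; rewrite ?addr0 // -addrA [b + a]addrC.
Qed.

Lemma move_bij i a : bijective (move i a).
Proof.
by exists (move i (- a)) => v; rewrite moveD ?addNr ?addrN;
  apply/ffunP => j; rewrite !ffunE; case: ifP => _; rewrite addr0.
Qed.

Definition behind g v : {set V} :=
  [set move (dir g) (- k.+1%:R) v | k : 'I_m]%SET.

Lemma mem_behind g v i k : (i < k <= m)%N ->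
  move (dir g) i%:R v \in behind g (move (dir g) k%:R v).
Proof.
move=> /andP[ik km]; have lt : ((k - i).-1 < m)%N by lia.
apply/imsetP; exists (Ordinal lt) => //=.
rewrite moveD; congr move.
have -> : (k - i).-1.+1 = (k - i)%N by lia.
by rewrite natrB ?(ltnW ik) // opprB subrK.
Qed.

(** Linear forms on [V] whose slopes along the direction labelled [g] are the entries of [g]. The
    vector of slopes therefore identifies the direction. *)
Definition level v (k : 'I_m) : 'F_q := \sum_g v (dir g) * g k.

Lemma level_move g a v k : level (move (dir g) a v) k = level v k + a * g k.
Proof.
rewrite /level (bigD1 g) //= ffunE eqxx mulrDl [RHS]addrC.
rewrite [in RHS](bigD1 g) //= addrA [a * _ + _]addrC; congr (_ + _).
apply: eq_bigr => h hg; rewrite ffunE; case: eqP => [/dir_inj hgE|_].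
  by rewrite hgE eqxx in hg.
by rewrite addr0.
Qed.

(** For uniform [c], each of the [m] equations holds at a given site with probability [1 / q]. *)
Definition zero_level c : {set V} := [set v | [exists k, level v k + c k == 0]].

(* The only direction along which the [k.+1]-st site behind [v] has [k]-th level
   [- c k], for every [k]. *)
Definition zero_dir v c : G := [ffun k : 'I_m => (level v k + c k) / k.+1%:R].

(** Going back [k.+1] steps lowers the [k]-th level by [k.+1] times the slope, which is exactly
    [level v k + c k]. Here [k.+1] is invertible because [k.+1 <= m < q]. *)
Lemma behind_zero_level v c : behind (zero_dir v c) v \subset zero_level c.
Proof.
apply/fintype.subsetP => u /imsetP[k _ ->]; rewrite inE; apply/existsP; exists k.
rewrite level_move ffunE addrAC mulNr mulrCA divff ?mulr1 ?subrr //.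
by rewrite -(dvdn_pcharf (pchar_Fp q_prime)) gtnNdvd // (leq_ltn_trans (ltn_ord k)).
Qed.

(** Each entry is affine in [c k] with invertible slope; hence at a fixed site a uniform offset
    yields a uniform direction. *)
Lemma zero_dir_bij v : bijective (zero_dir v).
Proof.
have k0 (k : 'I_m) : k.+1%:R != 0 :> 'F_q.
  by rewrite -(dvdn_pcharf (pchar_Fp q_prime)) gtnNdvd // (leq_ltn_trans (ltn_ord k)).
exists (fun g => [ffun k : 'I_m => g k * k.+1%:R - level v k]) => g.
  by apply/ffunP => k; rewrite !ffunE divfK // addrC addKr.
by apply/ffunP => k; rewrite !ffunE addrCA subrr addr0 mulfK.
Qed.

(** Double counting over pairs of a site and an offset, with a union bound over the [m]
    equations. *)
Lemma sum_card_zero_level : ((\sum_c #|zero_level c|) * q <= m * #|V| * #|G|)%N.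
Proof.
have -> : (\sum_c #|zero_level c| =
    \sum_v #|[set c : G | [exists k, level v k + c k == 0]%R]|)%N.
  under eq_bigr => c _ do rewrite -sum1_card big_mkcond /=.
  rewrite exchange_big /=; apply: eq_bigr => v _.
  rewrite -sum1_card [RHS]big_mkcond /=; apply: eq_bigr => c _.
  by rewrite !inE.
rewrite big_distrl /= -mulnA mulnCA -sum_nat_const; apply: leq_sum => v _.
apply: (@leq_trans (\sum_(k < m) #|[set c : G | c k == - level v k]| * q)%N).
  rewrite -big_distrl /= leq_mul2r; apply/orP; right.
  rewrite -sum1_card; under [leqRHS]eq_bigr => k _ do rewrite -sum1_card big_mkcond /=.
  rewrite exchange_big /= big_mkcond /=; apply: leq_sum => c _.
  rewrite inE; case: ifP => // /existsP[k kc]; rewrite (bigD1 k) //= inE.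
  by rewrite -addr_eq0 addrC kc.
have <- : (\sum_(k < m) #|{: G}| = m * #|{: G}|)%N by rewrite sum_nat_const card_ord.
apply: leq_sum => k _.
by have := card_ffun_eq k (- level v k); rewrite (card_Fp q_prime) => ->.
Qed.

(** Words of [m] steps along direction [i] wrap around the torus only from the last [m] values of
    the coordinate. *)
Lemma card_wrap (i : 'I_d) :
  (#|[set v : V | q <= v i + m]| * q <= m * #|V|)%N.
Proof.
have -> : #|[set v : V | q <= v i + m]%N| =
    (\sum_(t : 'F_q | q <= t + m) #|[set v : V | v i == t]|)%N.
  rewrite -sum1_card (partition_big (fun v : V => v i) (fun t : 'F_q => (q <= t + m)%N)) /=.
    apply: eq_bigr => t tm; rewrite -sum1_card; apply: eq_bigl => v; rewrite !inE.
    by case: eqP => [->|]; rewrite ?tm ?andbF.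
  by move=> v; rewrite inE.
rewrite big_distrl /=.
rewrite (eq_bigr (fun=> #|{: V}|)); last first.
  by move=> t _; have := card_ffun_eq i t; rewrite (card_Fp q_prime).
rewrite sum_nat_const leq_mul2r; apply/orP; right.
pose f (t : 'F_q) : option 'I_m := insub (t + m - q)%N.
have fE (t : 'F_q) : (q <= t + m)%N -> exists2 k : 'I_m, f t = Some k & (k = t + m - q :> nat)%N.
  move=> qt; have tq : (t < q)%N by rewrite -[X in (_ < X)%N](Fp_cast q_prime) ltn_ord.
  have lt : (t + m - q < m)%N by lia.
  by exists (Ordinal lt) => //; rewrite /f insubT.
apply: (@leq_trans #|[set Some k | k : 'I_m]%SET|); last first.
  by rewrite card_imset ?card_ord // => k l [].
rewrite -(@card_in_imset _ _ f).
  apply: subset_leq_card; apply/fintype.subsetP => _ /imsetP[t tm ->].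
  by have [k -> _] := fE t tm; apply: imset_f.
move=> s t; rewrite !unfold_in => sm tm fst.
have [k1 e1 k1E] := fE s sm; have [k2 e2 k2E] := fE t tm.
by move: fst; rewrite e1 e2 => -[k12]; apply: val_inj => /=; move: k1E k2E; rewrite k12; lia.
Qed.

End Directions.

(** The terms on the right are, in order: the entropy on the conditioning set [S], the score of
    local products, the rare letters, and an error of order [1 / q] made of the wrapping words and
    of the entropy drops. As [C] is fixed before [lam] and [q], first [lam] and then [q] can be
    taken large. *)
Lemma ln_card_le_words (R : realType) (A : finType) (m : nat) (eps : R) :
  0 < eps -> exists2 C : R, 0 <= C &
  forall (q d : nat) (dir : {ffun 'I_m -> 'F_q} -> 'I_d)
      (Om : {set {ffun {ffun 'I_d -> 'F_q} -> A}})
      (L : pred {ffun 'I_m.+1 -> A}) (b lam : R),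
    prime q -> (m < q)%N -> injective dir -> (0 < #|Om|)%N -> 0 <= b -> 0 < lam ->
    (forall x, x \in Om -> forall (v : {ffun 'I_d -> 'F_q}) i, (v i + m < q)%N ->
       L [ffun k : 'I_m.+1 => x (move i k%:R v)]) ->
    (forall W : 'I_m.+1 -> {set A}, (forall k, W k != finset.set0) ->
       (forall w : {ffun 'I_m.+1 -> A}, (forall k, w k \in W k) -> L w) ->
       \sum_k ln #|W k|%:R <= b) ->
    ln #|Om|%:R <= (q ^ d)%:R * (ln #|A|%:R ^+ 2 / lam + b / m.+1%:R + eps +
      m%:R * (ln #|A|%:R + C * lam) / q%:R).
Proof.
move=> eps0; have [C C0 HC] := sum_site_ent_le_word A m.+1 eps0.
exists C => // q d dir Om L b lam q_prime mq dir_inj Om0 b0 lam0 OmL Lb.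
pose V := {ffun 'I_d -> 'F_q}; pose G := {ffun 'I_m -> 'F_q}.
pose a : R := ln #|A|%:R; pose W : R := #|Om|%:R.
have a0 : 0 <= a by apply: ln_nat_ge0.
have W0 : 0 < W by rewrite ltr0n.
have q0 : 0 < q%:R :> R by rewrite ltr0n prime_gt0.
have V0 : 0 < #|{: V}|%:R :> R.
  by rewrite ltr0n; apply/card_gt0P; exists [ffun=> 0].
have G0 : 0 < #|{: G}|%:R :> R.
  by rewrite ltr0n; apply/card_gt0P; exists [ffun=> 0].
have cardV : #|{: V}| = (q ^ d)%N by rewrite card_ffun (card_Fp q_prime) card_ord.
(* The penalty [lam] makes enlarging a minimizer unprofitable: added sites cannot lower the site
   entropies by more than their price. *)
pose Phi (S : {set V}) : R := \sum_v site_ent R Om v S + lam * W * #|S|%:R.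
have [S _ Smin] : exists2 S : {set V}, true & forall S', Phi S <= Phi S'.
  by case: (@Order.TotalTheory.arg_minP _ _ _ (finset.set0 : {set V}) xpredT Phi isT) => S _ h;
    exists S => // S'; apply: h.
pose Sg := \sum_v site_ent R Om v S.
have Sg0 : 0 <= Sg by apply: sumr_ge0 => v _; apply: site_ent_ge0.
(* Comparison of the minimizer with the empty set. *)
have S_small : lam * #|S|%:R <= #|{: V}|%:R * a.
  rewrite -(ler_pM2l W0).
  have := Smin finset.set0; rewrite /Phi cards0 mulr0 addr0 -/Sg.
  have : \sum_v site_ent R Om v finset.set0 <= #|{: V}|%:R * (W * a).
    by rewrite mulr_natl -sumr_const; apply: ler_sum => v _; apply: site_ent_le.
  by lra.
pose D g u := site_ent R Om u S - site_ent R Om u (S :|: behind dir g u).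
(* Comparison of the minimizer with its union with [zero_level dir c], which contains the segment
   behind every [u] in the direction chosen by [c]. *)
have D_code c : \sum_u D (zero_dir dir u c) u <= lam * W * #|zero_level dir c|%:R.
  apply: (@le_trans _ _ (\sum_u (site_ent R Om u S - site_ent R Om u (S :|: zero_level dir c)))).
    apply: ler_sum => u _; rewrite /D lerD2l lerN2; apply: site_ent_mono.
    by apply: finset.setUS; apply: behind_zero_level.
  rewrite sumrB -/Sg lerBlDr.
  have := Smin (S :|: zero_level dir c); rewrite /Phi -/Sg.
  have : lam * W * #|S :|: zero_level dir c|%:R <= lam * W * (#|S|%:R + #|zero_level dir c|%:R).
    rewrite ler_wpM2l ?mulr_ge0 ?(ltW lam0) ?(ltW W0) //.
    by rewrite -natrD ler_nat cardsU leq_subr.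
  by lra.
have sumD : \sum_g \sum_u D g u <= lam * W * (m%:R * #|{: V}|%:R * #|{: G}|%:R / q%:R).
  rewrite exchange_big /=.
  (* At each site [u] separately, the sum over directions becomes a sum over offsets. *)
  rewrite (eq_bigr (fun u => \sum_c D (zero_dir dir u c) u)); last first.
    by move=> u _; apply: (reindex (zero_dir dir u)); apply/onW_bij/zero_dir_bij.
  rewrite exchange_big /=.
  apply: (@le_trans _ _ (\sum_c lam * W * #|zero_level dir c|%:R)).
    by apply: ler_sum => c _; apply: D_code.
  rewrite -mulr_sumr ler_wpM2l ?mulr_ge0 ?(ltW lam0) ?(ltW W0) //.
  rewrite ler_pdivlMr // -natr_sum -!natrM ler_nat.
  exact: sum_card_zero_level.
have line g : m.+1%:R * Sg <= #|{: V}|%:R * (W * (b + m.+1%:R * eps)) +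
    m%:R * #|{: V}|%:R / q%:R * (m.+1%:R * (W * a)) + C * (m.+1%:R * \sum_u D g u).
  (* Over all starting points of words along one direction, each site is visited once at every
     position. *)
  have shift (F : V -> R) : m.+1%:R * \sum_u F u =
      \sum_v \sum_(k < m.+1) F (move (dir g) k%:R v).
    rewrite exchange_big /= mulr_natl -[X in _ *+ X]card_ord -sumr_const.
    apply: eq_bigr => k _; rewrite (reindex (move (dir g) k%:R)) //.
    by apply: onW_bij; apply: move_bij.
  rewrite /Sg !shift.
  apply: (@le_trans _ _ (\sum_(v : V) (W * (b + m.+1%:R * eps) +
     (q <= v (dir g) + m)%N%:R * (m.+1%:R * (W * a)) +
     C * \sum_(k < m.+1) D g (move (dir g) k%:R v)))).
    (* Wrapping words may fail [L], and are bounded trivially. *)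
    apply: ler_sum => v _; have [wrap|nowrap] := leqP q (v (dir g) + m).
      rewrite mul1r.
      have : \sum_(k < m.+1) site_ent R Om (move (dir g) k%:R v) S <= m.+1%:R * (W * a).
        rewrite mulr_natl -[X in _ *+ X]card_ord -sumr_const.
        by apply: ler_sum => k _; apply: site_ent_le.
      have : 0 <= W * (b + m.+1%:R * eps).
        by rewrite mulr_ge0 ?(ltW W0) // addr_ge0 // mulr_ge0 // ltW.
      have : 0 <= C * \sum_(k < m.+1) D g (move (dir g) k%:R v).
        rewrite mulr_ge0 // sumr_ge0 // => k _; rewrite subr_ge0.
        by apply: site_ent_mono; apply: finset.subsetUl.
      by lra.
    rewrite mul0r addr0.
    apply: (HC _ Om S (fun k => move (dir g) k%:R v) L b
      (fun k => behind dir g (move (dir g) k%:R v))) => //.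
      by move=> x xO; apply: OmL.
    by move=> k i ikn; apply: mem_behind.
  rewrite !big_split /= sumr_const -[_ *+ _]mulr_natl -mulr_sumr lerD2r lerD2l.
  rewrite -mulr_suml ler_wpM2r ?mulr_ge0 ?(ltW W0) //.
  rewrite ler_pdivlMr // -natr_sum -!natrM ler_nat.
  apply: leq_trans (card_wrap q_prime mq (dir g)); rewrite leq_mul2r; apply/orP; right.
  by rewrite -sum1_card [leqRHS]big_mkcond; apply: leq_sum => v _; rewrite inE; case: (q <= _)%N.
have all_lines : m.+1%:R * Sg <= #|{: V}|%:R * (W * (b + m.+1%:R * eps)) +
    m%:R * #|{: V}|%:R / q%:R * (m.+1%:R * (W * a)) +
    C * (m.+1%:R * (lam * W * (m%:R * #|{: V}|%:R / q%:R))).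
  rewrite -(ler_pM2l G0).
  have : \sum_(g : G) m.+1%:R * Sg <= \sum_(g : G) (#|{: V}|%:R * (W * (b + m.+1%:R * eps)) +
    m%:R * #|{: V}|%:R / q%:R * (m.+1%:R * (W * a)) + C * (m.+1%:R * \sum_u D g u)).
    by apply: ler_sum => g _; apply: line.
  rewrite big_split /= !sumr_const -[X in X <= _]mulr_natl -[X in X + _]mulr_natl.
  rewrite -!mulr_sumr => h; apply: le_trans h _; rewrite [leRHS]mulrDr lerD2l.
  have := ler_wpM2l C0 (ler_wpM2l (ler0n R m.+1) sumD).
  by move/le_trans; apply; rewrite le_eqVlt; apply/orP; left; apply/eqP; ring.
have := @ln_card_le_site_ent R V A Om S; rewrite -/W -/Sg -/a => top.
rewrite -/a -cardV -(ler_pM2l W0); apply: le_trans top _.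
have n0 : 0 < m.+1%:R :> R by rewrite ltr0n.
have -> : W * (#|{: V}|%:R * (a ^+ 2 / lam + b / m.+1%:R + eps +
      m%:R * (a + C * lam) / q%:R)) = (W * a) * (#|{: V}|%:R * a / lam) +
   (#|{: V}|%:R * (W * (b + m.+1%:R * eps)) +
    m%:R * #|{: V}|%:R / q%:R * (m.+1%:R * (W * a)) +
    C * (m.+1%:R * (lam * W * (m%:R * #|{: V}|%:R / q%:R)))) / m.+1%:R.
  by field; rewrite !gt_eqF.
apply: lerD.
  rewrite mulrC ler_wpM2l ?mulr_ge0 ?(ltW W0) //.
  by rewrite ler_pdivlMr // mulrC.
by rewrite ler_pdivlMr // mulrC.
Qed.

(** * Independence scores and compactness *)

Local Open Scope classical_set_scope.

(** Fekete's argument for cubes: dividing by the volume bounds the ratio at [n] by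
    [(1 / m.*2.+1 + 1 / n.+1) ^+ d * u m], which tends to the ratio at [m]. The limit is thus the
    infimum of the ratios. *)
Lemma fekete_cubes (R : realType) (d : nat) (u : nat -> R) :
  (forall n, 0 <= u n) ->
  (forall m n, u n <= (((n.*2.+1 %/ m.*2.+1).+1) ^ d)%:R * u m) ->
  exists2 l : R, (fun n => u n / (n.*2.+1 ^ d)%:R) @ \oo --> l &
    forall n, l <= u n / (n.*2.+1 ^ d)%:R.
Proof.
move=> u0 uS; pose v n := u n / (n.*2.+1 ^ d)%:R.
have v0 n : 0 <= v n by rewrite divr_ge0.
have lbv : has_lbound (range v) by exists 0 => _ [n _ <-].
have infv : has_inf (range v) by split => //; exists (v 0%N); exists 0%N.
have vlow n : inf (range v) <= v n by apply: ge_inf => //; exists n.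
exists (inf (range v)) => //; apply/cvgrPdistC_le => eps eps0.
have eps2 : 0 < eps / 2 by rewrite divr_gt0.
have [_ [m _ <-] vm] := inf_adherent eps2 infv.
pose b : R := m.*2.+1%:R^-1.
have cb : (fun n => (b + harmonic n) ^+ d * u m) @ \oo --> v m.
  have -> : v m = (b + 0) ^+ d * u m.
    by rewrite addr0 /b exprVn -natrX /v mulrC.
  apply: cvgMr_tmp.
  have cbh : (fun n => b + harmonic n) @ \oo --> b + 0.
    by apply: cvgD; [exact: cvg_cst|exact: cvg_harmonic].
  exact: cvg_comp _ _ cbh (@exprn_continuous R d (b + 0)).
move/cvgrPdistC_le : cb => /(_ _ eps2); apply: filterS => n.
rewrite ler_distl => /andP[_ hn]; rewrite ger0_norm ?subr_ge0 ?vlow //.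
rewrite lerBlDl; apply: (@le_trans _ _ ((b + harmonic n) ^+ d * u m)); last first.
  by apply: le_trans hn _; lra.
rewrite /v ler_pdivrMr ?ltr0n ?expn_gt0 //.
apply: le_trans (uS m n) _; rewrite mulrAC ler_wpM2r // !natrX -exprMn.
apply: lerXn2r; rewrite ?nnegrE ?mulr_ge0 ?addr_ge0 ?invr_ge0 //.
rewrite mulrDl -[X in X <= _]natr1 lerD //.
  rewrite mulrC ler_pdivlMr ?ltr0n // -natrM ler_nat; exact: leq_divM.
rewrite /= ler_pdivlMl ?ltr0n // mulr1 ler_nat; lia.
Qed.

(** * Multi-choice points and compactness *)

Section Subshift.
Variables (A : finType) (X : set (int -> A)).
Hypothesis X_subshift : subshift X.

Lemma subshift_limit (x : int -> A) :
  (forall K : nat, exists2 y, X y & forall t : int, `|t| <= K%:Z -> y t = x t) -> X x.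
Proof.
move=> Xx; have /choice[y yP] (K : nat) :
    exists y, X y /\ forall t : int, `|t| <= K%:Z -> y t = x t.
  by have [z Xz zx] := Xx K; exists z.
have [Xcl _] := X_subshift.
apply: (@closed_cvg nat (prod_topology (fun _ : int => discrete_topology A)) \oo _ y X Xcl).
  by apply: nearW => K; have [] := yP K.
apply/cvg_sup => t U [V] [[W] oW <-] Wx WU; apply: (filterS WU).
rewrite nbhs_simpl; exists (absz t) => // K /= tK.
have [_ yx] := yP K; rewrite /= yx //; lia.
Qed.

(** Since [B] is finite, every coordinate is constant on a set of the ultrafilter; this replaces the
    extraction of a convergent subsequence. *)
Lemma ultrafilter_limit (B : finType) (U : set_system nat) (y : nat -> int -> B) :
  UltraFilter U -> exists z : int -> B,
  forall K : nat, U [set N | forall t : int, `|t| <= K%:Z -> y N t = z t].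
Proof.
move=> UU.
have /choice[z zP] t : exists b, U [set N | y N t = b].
  apply: contrapT => nb.
  have : \forall N \near U, forall b, y N t <> b.
    apply: filter_forall => b.
    have [Ub|//] := in_ultra_setVsetC [set N | y N t = b] UU.
    by exfalso; apply: nb; exists b.
  move=> UF; have [N /= NF] := filter_ex UF; exact: (NF (y N t)).
exists z => K.
have : \forall N \near U, forall i : 'I_(K.*2.+1), y N (i%:Z - K%:Z) = z (i%:Z - K%:Z).
  by apply: filter_forall => i; apply: zP.
apply: filterS => N NP t tK.
have lt : (absz (t + K%:Z)%R < K.*2.+1)%N by lia.
have := NP (Ordinal lt) => /=.
by have -> : (absz (t + K%:Z)%R)%:Z - K%:Z = t by lia.
Qed.

Local Notation Ah := (nonempty_subset A).

Definition compatible (xh : int -> Ah) (x : int -> A) := forall t, x t \in val (xh t).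

Lemma compatible_ex (xh : int -> Ah) : exists x, compatible xh x.
Proof.
have /choice[x xP] t : exists a, a \in val (xh t) by exact/set0Pn/(valP (xh t)).
by exists x.
Qed.

Lemma multi_choice_shift (v : int) (xh : int -> Ah) :
  multi_choice X xh -> multi_choice X (shift_by v xh).
Proof.
move=> Xxh x xP.
have -> : x = shift_by v (shift_by (- v) x).
  by apply/funext => t; rewrite /shift_by addrK.
apply: (X_subshift.2); apply: Xxh => t; rewrite /shift_by.
by have := xP (t - v); rewrite /shift_by subrK.
Qed.

(** A point of [X] gives a multi-choice point made of singletons. *)
Lemma multi_choice_neq0 : X !=set0 -> multi_choice X !=set0.
Proof.
move=> [x Xx].
have n0 t : [set x t]%SET != finset.set0 by apply/set0Pn; exists (x t); rewrite inE.
exists (fun t => exist (fun B : {set A} => B != finset.set0) _ (n0 t)) => y yx.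
suff -> : y = x by [].
by apply/funext => t; have := yx t; rewrite inE => /eqP.
Qed.

Section IndependenceSums.
Variable R : realType.

Definition block (xh : int -> Ah) (s : int) (n : nat) : R :=
  \sum_(i < n) ln #|val (xh (s + i%:Z))|%:R.

Lemma block_ge0 xh s n : 0 <= block xh s n.
Proof. by apply: sumr_ge0 => i _; apply: ln_nat_ge0. Qed.

Lemma block_le xh s n : block xh s n <= n%:R * ln #|A|%:R.
Proof.
rewrite mulr_natl -[X in _ *+ X]card_ord -sumr_const.
by apply: ler_sum => i _; apply: ler_ln_nat; apply: max_card.
Qed.

Lemma block_shift xh s r n : block (shift_by r xh) s n = block xh (s + r) n.
Proof. by apply: eq_bigr => i _; rewrite /shift_by addrAC. Qed.

Lemma blockD xh s m n : block xh s (m + n) = block xh s m + block xh (s + m%:Z) n.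
Proof.
rewrite /block big_split_ord /=; congr (_ + _).
by apply: eq_bigr => i _; rewrite PoszD addrA.
Qed.

Lemma blockM xh s k n : block xh s (k * n) = \sum_(j < k) block xh (s + (j * n)%N%:Z) n.
Proof.
elim: k => [|k IH]; first by rewrite mul0n /block !big_ord0.
by rewrite mulSn addnC blockD IH big_ord_recr.
Qed.

Lemma block_mono xh s m n : (m <= n)%N -> block xh s m <= block xh s n.
Proof. by move=> /subnKC <-; rewrite blockD lerDl block_ge0. Qed.

Definition max_block (n : nat) : R :=
  sup [set block xh 0 n | xh in multi_choice X].

Lemma has_ubound_block n :
  has_ubound [set block xh 0 n | xh in multi_choice X].
Proof. by exists (n%:R * ln #|A|%:R) => _ [xh _ <-]; apply: block_le. Qed.

Lemma le_max_block xh s n : multi_choice X xh -> block xh s n <= max_block n.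
Proof.
move=> Xxh; apply: ub_le_sup; first exact: has_ubound_block.
exists (shift_by s xh); first exact: multi_choice_shift.
by rewrite block_shift add0r.
Qed.

Hypothesis X0 : X !=set0.

Lemma max_block_le n (y : R) :
  (forall xh, multi_choice X xh -> block xh 0 n <= y) -> max_block n <= y.
Proof.
move=> By; apply: ge_sup; last by move=> _ [xh Xxh <-]; apply: By.
by have [xh Xxh] := multi_choice_neq0 X0; exists (block xh 0 n); exists xh.
Qed.

Lemma max_block_ge0 n : 0 <= max_block n.
Proof.
have [xh Xxh] := multi_choice_neq0 X0.
exact: le_trans (block_ge0 xh 0 n) (le_max_block _ _ Xxh).
Qed.

Lemma max_block_subadd m n : (0 < m)%N ->
  max_block n <= (n %/ m).+1%:R * max_block m.
Proof.
move=> m0; apply: max_block_le => xh Xxh.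
apply: (@le_trans _ _ (block xh 0 ((n %/ m).+1 * m))).
  by apply: block_mono; rewrite ltnW // ltn_ceil.
rewrite blockM mulr_natl -[X in _ *+ X]card_ord -sumr_const.
by apply: ler_sum => j _; apply: le_max_block.
Qed.

(** The condition of a multi-choice point, tested on one interval only: every choice agrees there
    with some point of [X]. *)
Definition local_on (xh : int -> Ah) (s : int) (n : nat) :=
  forall x, compatible xh x ->
  exists2 y, X y & forall i, (i < n)%N -> y (s + i%:Z) = x (s + i%:Z).

(** Compactness: counterexamples for all [N], recentered at their middle block, have an ultrafilter
    limit [z]. It is a multi-choice point and shares its block with one of them, so that block
    cannot exceed [max_block n]. *)
Lemma local_block_le n : exists N : nat, forall xh s,
  local_on xh s (N + n + N) -> block xh (s + N%:Z) n <= max_block n.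
Proof.
apply: contrapT => noN.
have /choice[xs xsP] N : exists p : (int -> Ah) * int,
    local_on p.1 p.2 (N + n + N) /\ max_block n < block p.1 (p.2 + N%:Z) n.
  apply: contrapT => noxh; apply: noN; exists N => xh s loc.
  by rewrite leNgt; apply/negP => lt; apply: noxh; exists (xh, s).
have [U [UU ooU]] := ultraFilterLemma (@eventually_filter : ProperFilter \oo).
pose y N := shift_by ((xs N).2 + N%:Z) (xs N).1.
have [z zP] := ultrafilter_limit y UU.
have zPK K : exists2 N, (K < N)%N & forall t : int, `|t| <= K%:Z -> y N t = z t.
  have UK : U [set N | (K < N)%N] by apply: ooU; exists K.+1.
  have [N /= [KN NP]] := filter_ex (filterI UK (zP K)).
  by exists N.
have Xz : multi_choice X z.
  move=> x xz; apply: subshift_limit => K.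
  have [N KN yz] := zPK K; have [loc _] := xsP N.
  have [w wP] := compatible_ex (y N).
  (* Follows [x] near the center, where [y N] and [z] agree, and any choice [w] of [y N]
     elsewhere. *)
  pose x' t := if `|t| <= K%:Z then x t else w t.
  have [|u Xu ux] := loc (shift_by (- ((xs N).2 + N%:Z)) x').
    move=> t; rewrite /shift_by /x'; case: ifP => tK.
      have := xz (t - ((xs N).2 + N%:Z)); rewrite -yz //.
      by rewrite /y /shift_by subrK.
    by have := wP (t - ((xs N).2 + N%:Z)); rewrite /y /shift_by subrK.
  exists (shift_by ((xs N).2 + N%:Z) u); first exact: X_subshift.2.
  move=> t tK; rewrite /shift_by.
  have -> : t + ((xs N).2 + N%:Z) = (xs N).2 + (absz (t + N%:Z)%R)%:Z by lia.
  rewrite ux; last by lia.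
  rewrite /shift_by.
  have -> : (xs N).2 + (absz (t + N%:Z)%R)%:Z - ((xs N).2 + N%:Z) = t by lia.
  by rewrite /x' tK.
have [N nN yz] := zPK n; have [_] := xsP N.
apply/negP; rewrite -leNgt.
have -> : block (xs N).1 ((xs N).2 + N%:Z) n = block z 0 n.
  rewrite -[X in block _ X]add0r -block_shift; apply: eq_bigr => i _.
  by rewrite -/(y N) yz //; have := ltn_ord i; lia.
exact: le_max_block.
Qed.

(** The word is cut into [k] blocks of length [n] between two margins of length [N]. Each block has
    the room that [local_block_le] asks for, and the margins are negligible for large [k]. *)
Lemma local_words_bound (n : nat) (eps : R) : (0 < n)%N -> 0 < eps ->
  exists m : nat, forall W : 'I_m.+1 -> {set A},
    (forall k, W k != finset.set0) ->
    (forall w : {ffun 'I_m.+1 -> A}, (forall k, w k \in W k) ->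
       exists2 x, X x & forall k : 'I_m.+1, w k = x k%:Z) ->
    \sum_k ln #|W k|%:R <= m.+1%:R * (max_block n / n%:R + eps).
Proof.
move=> n0 eps0; have [N HN] := local_block_le n.
pose a : R := ln #|A|%:R; have a0 : 0 <= a by apply: ln_nat_ge0.
have nR : 0 < n%:R :> R by rewrite ltr0n.
have [k k0 kP] : exists2 k, (0 < k)%N & N.*2%:R * a <= k%:R * n%:R * eps.
  exists (Num.truncn (N.*2%:R * a / (n%:R * eps))).+1 => //.
  rewrite -mulrA -ler_pdivrMr ?mulr_gt0 //.
  by apply: ltW; rewrite truncnS_gt.
pose m := (N + k * n + N).-1.
have mE : m.+1 = (N + k * n + N)%N by rewrite /m prednK // addnAC addnC ltn_addr // muln_gt0 k0.
exists m => W W0 WX.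
(* Outside the word [inord] falls back on sets of the word, which are nonempty, so [xh] is defined
   on all of [int]. *)
pose Wi (t : int) : {set A} := W (inord (absz t)).
pose xh (t : int) : Ah := exist (fun B : {set A} => B != finset.set0) (Wi t) (W0 _).
have -> : \sum_k ln #|W k|%:R = block xh 0 m.+1.
  by apply: eq_bigr => i _; rewrite /= /Wi add0r inord_val.
have loc j : (j < k)%N -> local_on xh (j * n)%N%:Z (N + n + N).
  move=> jk x xxh.
  have jn : (j.+1 * n <= k * n)%N by rewrite leq_mul2r jk orbT.
  have [i|y Xy yx] := WX [ffun i : 'I_m.+1 => x i%:Z].
    by rewrite ffunE; have := xxh i%:Z; rewrite /= /Wi /= inord_val.
  exists y => // i ilt.
  have lt : (j * n + i < m.+1)%N by rewrite mE; move: jn ilt; rewrite mulSn; lia.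
  by have := yx (Ordinal lt); rewrite ffunE /= PoszD => <-.
rewrite mE !blockD blockM.
have h1 : block xh 0 N <= N%:R * a by apply: block_le.
have h2 : block xh (0 + (N + k * n)%N%:Z) N <= N%:R * a by apply: block_le.
have h3 : \sum_(j < k) block xh (0 + N%:Z + (j * n)%N%:Z) n <= k%:R * max_block n.
  rewrite mulr_natl -[X in _ *+ X]card_ord -sumr_const; apply: ler_sum => j _.
  by rewrite add0r addrC; apply: HN; apply: loc.
apply: le_trans (lerD (lerD h1 h3) h2) _.
have s0 := max_block_ge0 n.
rewrite !natrD natrM.
have -> : k%:R * max_block n = k%:R * n%:R * (max_block n / n%:R).
  by field; rewrite gt_eqF.
have sn0 : 0 <= max_block n / n%:R by rewrite divr_ge0.
have N2 : N.*2%:R = N%:R + N%:R :> R by rewrite -addnn natrD.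
have NR : 0 <= N%:R :> R by [].
move: kP; rewrite N2; nra.
Qed.

End IndependenceSums.
End Subshift.

(** * Counting patterns of axial powers *)

Definition language_count (G : zmodType) (A : finType) (Y : set (G -> A))
  (S : {fset G}) : nat := #|` fset_set (language Y S)|.

Section LanguageCount.
Variables (G : zmodType) (A : finType) (Y : set (G -> A)).
Local Notation count := (language_count Y).

Lemma language_countE (S : {fset G}) :
  count S = #|[set w : {ffun S -> A} | `[< language Y S w >]]%SET|.
Proof.
rewrite /language_count -card_finset; congr (#|` _|).
apply/fsetP => w; rewrite in_fset_set; last exact: finite_finset.
by rewrite in_fset inE; apply/idP/asboolP => [/set_mem|/mem_set].
Qed.

Lemma language_count_le (S : {fset G}) (T : finType) (P : {set T})
    (f : {ffun S -> A} -> T) :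
  {in language Y S &, injective f} ->
  (forall w, language Y S w -> f w \in P) -> (count S <= #|P|)%N.
Proof.
move=> f_inj fP; rewrite language_countE.
rewrite -(@card_in_imset _ _ f); last first.
  by move=> w w' /[!inE] /asboolP Yw /asboolP Yw'; apply: f_inj; apply: mem_set.
apply: subset_leq_card; apply/fintype.subsetP => _ /imsetP[w /[!inE] /asboolP Yw ->].
exact: fP.
Qed.

Lemma language_count_ge (S : {fset G}) (P : {set {ffun S -> A}}) :
  (forall w, w \in P -> language Y S w) -> (#|P| <= count S)%N.
Proof.
move=> PY; rewrite language_countE; apply: subset_leq_card.
by apply/fintype.subsetP => w wP; rewrite inE; apply/asboolP/PY.
Qed.

(** Patterns outside the language are sent to a default point of [Y]. *)
Lemma language_extension (S : {fset G}) : Y !=set0 ->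
  exists y : {ffun S -> A} -> G -> A,
    forall w, Y (y w) /\ (language Y S w -> forall s : S, w s = y w (val s)).
Proof.
move=> [y0 Yy0].
have /choice[y yP] (w : {ffun S -> A}) : exists y, Y y /\
    (language Y S w -> forall s : S, w s = y (val s)).
  have [[y Yy <-]|nw] := pselect (language Y S w).
    by exists y; split => // _ s; rewrite ffunE.
  by exists y0; split.
by exists y.
Qed.

Hypothesis Y_shift : forall v y, Y y -> Y (shift_by v y).

(** A pattern on [S] is determined by the patterns that its extension shows on the translates of
    [T]. *)
Lemma language_count_cover (S T : {fset G}) (J : finType) (c : J -> G) :
  Y !=set0 ->
  (forall s, s \in S -> exists j, exists2 t, t \in T & s = t + c j) ->
  (count S <= count T ^ #|J|)%N.
Proof.
move=> Y0 ST; have [y yP] := language_extension S Y0.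
rewrite (language_countE T).
set P := [set w | _]%SET.
have -> : (#|P| ^ #|J|)%N = #|([set g in ffun_on (mem P)]%SET : {set {ffun J -> {ffun T -> A}}})|.
  by rewrite [RHS]cardsE card_ffun_on.
apply: (@language_count_le S _ _
  (fun w => [ffun j => restriction T (shift_by (c j) (y w))])) => [w w'|w Yw].
  move=> /set_mem Yw /set_mem Yw' eq_ww'; apply/ffunP => s.
  have [j [t tT st]] := ST _ (valP s).
  rewrite (yP w).2 // (yP w').2 // st.
  by have /ffunP/(_ j) := eq_ww'; rewrite !ffunE => /ffunP/(_ [` tT]%fset); rewrite !ffunE.
rewrite inE; apply/ffun_onP => j; rewrite ffunE inE; apply/asboolP.
exists (shift_by (c j) (y w)) => //; apply: Y_shift; exact: (yP w).1.
Qed.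

(** Transfers patterns to an arbitrary index type [V], later the sites of the torus. *)
Lemma language_count_patterns (S : {fset G}) (V : finType) (p : V -> G) (c : G) :
  Y !=set0 -> (forall s, s \in S -> exists v, s = p v + c) ->
  (count S <= #|[set x : {ffun V -> A} |
    `[< exists2 y, Y y & forall v, x v = y (p v) >]]%SET|)%N.
Proof.
move=> Y0 Sp; have [y yP] := language_extension S Y0.
apply: (@language_count_le S _ _
  (fun w => [ffun v => y w (p v + c)])) => [w w'|w Yw].
  move=> /set_mem Yw /set_mem Yw' eq_ww'; apply/ffunP => s.
  have [v sv] := Sp _ (valP s).
  rewrite (yP w).2 // (yP w').2 // sv.
  by have /ffunP/(_ v) := eq_ww'; rewrite !ffunE.
rewrite inE; apply/asboolP; exists (shift_by c (y w)); last by move=> v; rewrite ffunE.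
by apply: Y_shift; exact: (yP w).1.
Qed.

End LanguageCount.

Lemma mem_box (d n : nat) (v : 'rV[int]_d) :
  reflect (forall i, `|v 0 i| <= n%:Z) (v \in box d n).
Proof.
rewrite in_fset_set; last exact: finite_box.
by apply: (iffP idP) => [/set_mem|vn]; [|apply: mem_set].
Qed.

Lemma card_box (d n : nat) : #|` box d n| = (n.*2.+1 ^ d)%N.
Proof.
pose f (w : {ffun 'I_d -> 'I_n.*2.+1}) : 'rV[int]_d := \row_i ((w i)%:Z - n%:Z).
have f_inj : injective f.
  move=> w w' /rowP ww'; apply/ffunP => i; have := ww' i; rewrite !mxE => wi.
  by apply: val_inj => /=; lia.
have -> : box d n = [fset f w | w in {: {ffun 'I_d -> 'I_n.*2.+1}}]%fset.
  apply/fsetP => v; apply/mem_box/imfsetP => [vn|[w _ ->] i]; last first.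
    by rewrite mxE; move: (w i) => k; have := ltn_ord k; lia.
  exists [ffun i => inord (absz (v 0 i + n%:Z)%R)] => //.
  apply/rowP => i; rewrite mxE ffunE; move: (v 0 i) (vn i) => k kn.
  by rewrite inordK; lia.
by rewrite card_imfset //= -cardE card_ffun !card_ord.
Qed.

(** * Points of axial powers built from multi-choice points *)

Section AxialPower.
Variables (A : finType) (X : set (int -> A)).
Hypothesis X_subshift : subshift X.

Lemma axial_power_shift d v x :
  axial_power X d x -> axial_power X d (shift_by v x).
Proof.
move=> Xx g i; rewrite /shift_by; have := Xx (g + v) i.
by congr (X _); apply/funext => t; rewrite addrAC.
Qed.

Definition coord_sum d (v : 'rV[int]_d) : int := \sum_i v 0 i.

Lemma coord_sum_line d (v : 'rV[int]_d) (i : 'I_d) (t : int) :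
  coord_sum (v + t *: delta_mx 0 i) = coord_sum v + t.
Proof.
rewrite /coord_sum; under eq_bigr do rewrite !mxE eqxx /=.
rewrite big_split /=; congr (_ + _); rewrite (bigD1 i) //= eqxx mulr1 big1 ?addr0 //.
by move=> j /negbTE ->; rewrite mulr0.
Qed.

(** Along each coordinate line [coord_sum] grows by one per step, so the line reads a choice of a
    shift of [xh]. *)
Lemma axial_power_sum d (xh : int -> nonempty_subset A) (y : 'rV[int]_d -> A) :
  multi_choice X xh -> (forall v, y v \in val (xh (coord_sum v))) ->
  axial_power X d y.
Proof.
move=> Xxh yxh g i; have Xs := @multi_choice_shift _ _ X_subshift (coord_sum g) _ Xxh.
refine (Xs _ _) => t.
by rewrite /shift_by (addrC t) -(coord_sum_line g i); apply: yxh.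
Qed.

Lemma axial_power_neq0 d : X !=set0 -> axial_power X d !=set0.
Proof.
move=> /(multi_choice_neq0)[xh Xxh]; have [x xxh] := compatible_ex xh.
by exists (x \o @coord_sum d); apply: axial_power_sum Xxh _ => v; apply: xxh.
Qed.

Lemma prod_card_le_language d (S : {fset 'rV[int]_d}) (xh : int -> nonempty_subset A) :
  multi_choice X xh ->
  (\prod_(s : S) #|val (xh (coord_sum (val s)))| <= language_count (axial_power X d) S)%N.
Proof.
move=> Xxh; pose F (s : S) := mem (val (xh (coord_sum (val s)))).
have -> : (\prod_(s : S) #|val (xh (coord_sum (val s)))| =
    #|([set w in family F]%SET : {set {ffun S -> A}})|)%N.
  by rewrite cardsE card_family foldrE big_map -big_enum.
have [x xxh] := compatible_ex xh.
apply: language_count_ge => w; rewrite inE => /familyP wF.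
exists (fun v => if insub v is Some s then w s else x (coord_sum v)); last first.
  by apply/ffunP => s; rewrite ffunE valK.
apply: axial_power_sum Xxh _ => v; case: insubP => [s _ <-|_]; last exact: xxh.
exact: wF.
Qed.

End AxialPower.

(** * Lower and upper bounds for the number of box patterns *)

Section Bounds.
Variables (R : realType) (A : finType) (X : set (int -> A)).
Hypothesis X_subshift : subshift X.
Hypothesis X0 : X !=set0.
Local Notation count d n := (language_count (axial_power X d) (box d n)).
Local Notation max_block := (max_block X R).

Lemma count_gt0 d n : (0 < count d n)%N.
Proof.
have [xh Xxh] := multi_choice_neq0 X0.
apply: leq_trans (prod_card_le_language X_subshift (box d n) Xxh).
by rewrite prodn_gt0 // => s; rewrite card_gt0 (valP (xh _)).
Qed.

Lemma count_box_subadd d m n :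
  (count d n <= count d m ^ ((n.*2.+1 %/ m.*2.+1).+1 ^ d))%N.
Proof.
set k := (_ %/ _).+1.
(* Centers of a grid of cubes of side [m.*2.+1] that starts at the corner [- n]. *)
pose c (j : {ffun 'I_d -> 'I_k}) : 'rV[int]_d :=
  \row_i ((m.*2.+1 * j i)%N%:Z + m%:Z - n%:Z).
have -> : (k ^ d = #|{: {ffun 'I_d -> 'I_k}}|)%N by rewrite card_ffun !card_ord.
apply: (@language_count_cover _ _ _ _ _ _ _ c).
- exact: axial_power_shift.
- exact: axial_power_neq0.
move=> v /mem_box vn.
pose q i := (absz (v 0 i + n%:Z)%R %/ m.*2.+1)%N.
have qk i : (q i < k)%N.
  by rewrite /k ltnS /q leq_div2r //; move: (v 0 i) (vn i) => t tn; lia.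
exists [ffun i => inord (q i)].
exists (v - c [ffun i => inord (q i)]); last by rewrite subrK.
apply/mem_box => i; rewrite !mxE ffunE inordK //.
have := divn_eq (absz (v 0 i + n%:Z)%R) m.*2.+1.
have := ltn_pmod (absz (v 0 i + n%:Z)%R) (ltn0Sn m.*2).
rewrite -/(q i) mulnC; set p := (_ * q i)%N; set r := (_ %% _)%N.
by move: (v 0 i) (vn i) p r => t tn p r; lia.
Qed.

Lemma block_ge_shift (xh : int -> nonempty_subset A) (s : int) (n : nat) :
  block R xh 0 n - (absz s)%:R * ln #|A|%:R <= block R xh s n.
Proof.
have [s0|s0] := leP 0 s.
  have e1 : block R xh 0 (absz s + n) = block R xh 0 (absz s) + block R xh s n.
    by rewrite blockD add0r gez0_abs.
  have := @block_le _ R xh 0 (absz s).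
  have : block R xh 0 n <= block R xh 0 (absz s + n) by apply: block_mono; apply: leq_addl.
  by rewrite e1; lra.
have e1 : block R xh s (absz s + n) = block R xh s (absz s) + block R xh 0 n.
  by rewrite blockD; congr (_ + block _ _ _ _); lia.
have e2 : block R xh s (absz s + n) = block R xh s n + block R xh (s + n%:Z) (absz s).
  by rewrite addnC blockD.
have := @block_le _ R xh (s + n%:Z) (absz s).
have := block_ge0 R xh s (absz s).
by move: e2; rewrite e1; lra.
Qed.

Lemma coord_sum_box d n v : v \in box d n -> (absz (coord_sum v) <= d * n)%N.
Proof.
move=> /mem_box vn; rewrite -lez_nat -[X in X <= _]/(`|coord_sum v|).
apply: le_trans (ler_norm_sum _ _ _) _.
apply: (@le_trans _ _ (\sum_(i < d) n%:Z)); first exact: ler_sum.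
by rewrite sumr_const card_ord -mulr_natl -natz PoszM !natz.
Qed.

(** Each of [M] shifts of [xh] gives a product inside the language of the box. Summed over the
    shifts, the scores at a site form a block of length [M] starting at its coordinate sum, at most
    [d * n] away from [0]. *)
Lemma ln_count_ge d n M :
  (n.*2.+1 ^ d)%:R * (max_block M - (d * n)%:R * ln #|A|%:R) <=
  M%:R * ln (count d n)%:R.
Proof.
set a := ln #|A|%:R.
have B0 : 0 < (n.*2.+1 ^ d)%:R :> R by rewrite ltr0n expn_gt0.
rewrite -ler_pdivlMl // lerBlDr; apply: max_block_le => // xh Xxh.
rewrite -lerBlDr ler_pdivlMl //.
have single (t : int) : \sum_(s : box d n) ln #|val (xh (coord_sum (val s) + t))|%:R <=
    ln (count d n)%:R :> R.
  have Xt := @multi_choice_shift _ _ X_subshift t _ Xxh.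
  rewrite -ln_prod; last by move=> s; rewrite ltr0n card_gt0 (valP (xh _)).
  rewrite -natr_prod; apply: ler_ln_nat.
  exact: (prod_card_le_language X_subshift (box d n) Xt).
have : \sum_(t < M) \sum_(s : box d n) ln #|val (xh (coord_sum (val s) + t%:Z))|%:R <=
    M%:R * ln (count d n)%:R :> R.
  rewrite mulr_natl -[X in _ *+ X]card_ord -sumr_const.
  by apply: ler_sum => t _; apply: single.
apply: le_trans; rewrite exchange_big /=; set y := _ - _.
have -> : (n.*2.+1 ^ d)%:R * y = \sum_(s : box d n) y.
  by rewrite sumr_const -cardfE card_box mulr_natl.
apply: ler_sum => s _; apply: le_trans (block_ge_shift xh (coord_sum (val s)) M).
rewrite lerD2l lerN2 ler_wpM2r ?ln_nat_ge0 // ler_nat.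
exact: coord_sum_box (valP s).
Qed.

Lemma prime_field_shift q d (v : {ffun 'I_d -> 'F_q}) i k :
  prime q -> (v i + k < q)%N ->
  (\row_j (move i k%:R v j : nat)%:Z : 'rV[int]_d) =
  (\row_j (v j : nat)%:Z) + k%:Z *: delta_mx 0 i.
Proof.
move=> q_prime vk; apply/rowP => j; rewrite !mxE !ffunE eqxx andTb.
have [->|_] := eqVneq j i; last by rewrite addr0 mulr0 addr0.
rewrite mulr1 -PoszD; congr Posz.
by rewrite -{1}[v i]natr_Zp -natrD val_Fp_nat // modn_small.
Qed.

(** The parameters are chosen in the order [m], [C], [lam], [q], [d], each depending on the previous
    ones; four errors of size at most [eps / 4] add up. *)
Lemma ln_count_le (n : nat) (eps : R) : (0 < n)%N -> 0 < eps ->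
  exists D : nat, forall d, (D <= d)%N -> exists N,
    ln (count d N)%:R <=
      (N.*2.+1 ^ d)%:R * (max_block n / n%:R + eps).
Proof.
move=> n0 eps0; pose e := eps / 4; have e0 : 0 < e by rewrite divr_gt0.
have [m mP] := local_words_bound X_subshift X0 n0 e0.
have [C C0 CP] := ln_card_le_words A m e0.
pose a : R := ln #|A|%:R; have a0 : 0 <= a by apply: ln_nat_ge0.
pose b : R := m.+1%:R * (max_block n / n%:R + e).
have b0 : 0 <= b.
  by rewrite mulr_ge0 // addr_ge0 ?(ltW e0) // divr_ge0 // max_block_ge0.
(* Makes [a ^+ 2 / lam <= e]; the summand [1] keeps [lam] positive when [a = 0]. *)
pose lam := a ^+ 2 / e + 1.
have lam0 : 0 < lam by rewrite ltr_wpDl // divr_ge0 ?exprn_ge0 // ltW.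
(* [q > 2] makes [q] odd, hence the side of a box; the other two bounds give [m < q] and a last
   error of at most [e]. *)
have [q qlt q_prime] := prime_above
  (maxn 2 (maxn m (Num.truncn (m%:R * (a + C * lam) / e)).+1)).
move: qlt; rewrite !gtn_max => /and3P[q2 mq qlt].
have q0 : 0 < q%:R :> R by rewrite ltr0n prime_gt0.
have qe : m%:R * (a + C * lam) / q%:R <= e.
  rewrite ler_pdivrMr // [leRHS]mulrC -ler_pdivrMr //.
  apply: ltW; apply: lt_le_trans (truncnS_gt _) _; rewrite ler_nat; exact: ltnW.
have q_odd : q = (q./2).*2.+1.
  have := odd_double_half q; have /even_prime := q_prime.
  by case=> [q2E|->]; [rewrite q2E ltnn in q2|rewrite add1n].
exists (q ^ m)%N => d qd; exists q./2; rewrite -q_odd.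
have cardG : #|{: {ffun 'I_m -> 'F_q}}| = (q ^ m)%N.
  by rewrite card_ffun (card_Fp q_prime) card_ord.
have Gd : (#|{: {ffun 'I_m -> 'F_q}}| <= d)%N by rewrite cardG.
pose dir (g : {ffun 'I_m -> 'F_q}) : 'I_d := widen_ord Gd (enum_rank g).
have dir_inj : injective dir by move=> g h gh; apply/enum_rank_inj/val_inj; exact: (congr1 val gh).
pose p (v : {ffun 'I_d -> 'F_q}) : 'rV[int]_d := \row_j (v j : nat)%:Z.
pose Om := [set x : {ffun {ffun 'I_d -> 'F_q} -> A} |
  `[< exists2 y, axial_power X d y & forall v, x v = y (p v) >]]%SET.
have count_Om : (count d q./2 <= #|Om|)%N.
  (* The box of radius [q./2] is the cube [[0, q)^d] moved by [- q./2], so residues index its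
     sites. *)
  apply: (@language_count_patterns _ _ _ _ _ _ p (\row_j (- (q./2)%:Z))).
  - exact: axial_power_shift.
  - exact: axial_power_neq0.
  move=> v /mem_box vq; exists [ffun i => (absz (v 0 i + (q./2)%:Z)%R)%:R].
  apply/rowP => i; rewrite !mxE ffunE val_Fp_nat //.
  move: (v 0 i) (vq i) => t tq; clear -tq q_odd; rewrite modn_small; first by lia.
  by rewrite [X in (_ < X)%N]q_odd; lia.
pose L (w : {ffun 'I_m.+1 -> A}) :=
  `[< exists2 x, X x & forall k : 'I_m.+1, w k = x k%:Z >].
apply: le_trans (ler_ln_nat R count_Om) _.
apply: le_trans (CP q d dir Om L b lam q_prime mq dir_inj _ b0 lam0 _ _) _.
- exact: leq_trans (count_gt0 d q./2) count_Om.
- move=> x; rewrite inE => /asboolP[y Yy xy] v i vm; apply/asboolP.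
  exists (fun t => y (p v + t *: delta_mx 0 i)); first exact: Yy.
  move=> k; rewrite ffunE xy /p prime_field_shift //.
  by apply: leq_ltn_trans vm; rewrite leq_add2l -ltnS.
- move=> W W0 WL; apply: mP => // w wW.
  by have /asboolP := WL w wW.
rewrite ler_wpM2l // -/a.
have -> : b / m.+1%:R = max_block n / n%:R + e by rewrite /b mulrAC divff ?mul1r.
have : a ^+ 2 / lam <= e.
  rewrite ler_pdivrMr // /lam mulrDr mulrCA divff ?gt_eqF // !mulr1; lra.
have : e = eps / 4 by [].
move: qe; lra.
Qed.

End Bounds.

(** * Limits *)

Lemma perm_int_window (n : nat) :
  perm_eq (int_window n) [seq (i : nat)%:Z - n%:Z | i : 'I_n.*2.+1].
Proof.
apply: uniq_perm; first exact: fset_uniq.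
  rewrite map_inj_uniq ?enum_uniq // => i j ij; apply: val_inj => /=; lia.
move=> t; rewrite in_fset_set; last exact: finite_int_window.
apply/idP/mapP => [/set_mem tn|[i _ ->]]; last first.
  by apply: mem_set; rewrite /int_window_set /=; have := ltn_ord i; lia.
have {}tn : `|t| <= n%:Z := tn.
exists (inord (absz (t + n%:Z)%R)); first by rewrite mem_enum.
by rewrite inordK; lia.
Qed.

Lemma card_int_window (n : nat) : #|` int_window n| = n.*2.+1.
Proof. by rewrite (perm_size (perm_int_window n)) size_map -cardE card_ord. Qed.

Section Limits.
Variables (R : realType) (A : finType) (X : set (int -> A)).
Hypothesis X_subshift : subshift X.

Lemma score_block (xh : int -> nonempty_subset A) (n : nat) :
  independence_score R (restriction (int_window n) xh) =
  block R xh (- n%:Z) n.*2.+1 / n.*2.+1%:R.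
Proof.
rewrite /independence_score card_int_window mulrC; congr (_ / _).
under eq_bigr do rewrite ffunE.
rewrite -(big_seq_fsetE _ (int_window n) xpredT (fun t => ln #|val (xh t)|%:R)) /=.
rewrite (perm_big _ (perm_int_window n)) big_map big_enum /=.
by apply: eq_bigr => i _; rewrite addrC.
Qed.

(** Shift invariance moves the symmetric window to one starting at [0]. *)
Lemma sup_score (n : nat) : X !=set0 ->
  ereal_sup [set (independence_score R w)%:E |
    w in language (multi_choice X) (int_window n)] =
  (max_block X R n.*2.+1 / n.*2.+1%:R)%:E.
Proof.
move=> X0; have n0 : 0 < n.*2.+1%:R :> R by rewrite ltr0n.
apply/eqP; rewrite eq_le; apply/andP; split.
  apply: ge_ereal_sup => _ [_ [xh Xxh <-] <-].
  by rewrite lee_fin score_block ler_pM2r ?invr_gt0 // le_max_block.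
set s := ereal_sup _.
have sP xh : multi_choice X xh -> ((block R xh 0 n.*2.+1 / n.*2.+1%:R)%:E <= s)%E.
  move=> Xxh; apply: ereal_sup_ubound.
  exists (restriction (int_window n) (shift_by n%:Z xh)).
    by exists (shift_by n%:Z xh) => //; apply: multi_choice_shift.
  by rewrite score_block block_shift addNr.
case: s sP => [r| |] sP; last 2 first.
- exact: leey.
- by have [xh /sP] := multi_choice_neq0 X0.
rewrite lee_fin ler_pdivrMr //; apply: max_block_le => // xh /sP.
by rewrite lee_fin ler_pdivrMr.
Qed.

Lemma limn_EFin (u : nat -> R) (v : nat -> \bar R) (l : R) :
  (forall n, v n = (u n)%:E) -> u @ \oo --> l -> limn v = l%:E.
Proof.
move=> /funext -> ul.
have uE := EFin_lim (cvgP l ul).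
by rewrite -[X in X%:E](cvg_lim (@Rhausdorff R) ul).
Qed.

Lemma independence_entropyE : X !=set0 -> exists2 h : R,
  independence_entropy R X = h%:E &
  (fun n => max_block X R n.*2.+1 / n.*2.+1%:R) @ \oo --> h /\
  forall n, h <= max_block X R n.*2.+1 / n.*2.+1%:R.
Proof.
move=> X0.
have [|m n|h hcvg hle] := @fekete_cubes R 1 (fun n => max_block X R n.*2.+1).
- by move=> n; apply: max_block_ge0.
- by rewrite expn1; apply: max_block_subadd.
rewrite (_ : (fun n => _) = (fun n => max_block X R n.*2.+1 / n.*2.+1%:R)) in hcvg;
  last by apply/funext => n; rewrite expn1.
exists h; last by split => // n; have := hle n; rewrite expn1.
by apply: limn_EFin hcvg => n; apply: sup_score.
Qed.

Lemma entropyE d : X !=set0 -> exists2 h : R,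
  entropy R (axial_power X d) = h%:E &
  (fun n => ln (language_count (axial_power X d) (box d n))%:R / (n.*2.+1 ^ d)%:R) @ \oo --> h /\
  forall n, h <= ln (language_count (axial_power X d) (box d n))%:R / (n.*2.+1 ^ d)%:R.
Proof.
move=> X0; set c := fun n => language_count (axial_power X d) (box d n).
have c0 n : (0 < c n)%N by apply: count_gt0.
have [|m n|h hcvg hle] := @fekete_cubes R d (fun n => ln (c n)%:R).
- by move=> n; apply: ln_nat_ge0.
- rewrite mulr_natl -lnXn ?ltr0n // -natrX; apply: ler_ln_nat.
  exact: count_box_subadd.
exists h => //; apply: limn_EFin hcvg => n.
rewrite -/(language_count (axial_power X d) (box d n)) -/(c n).
by rewrite lne_EFin ?ltr0n // card_box -EFinM mulrC.
Qed.

End Limits.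

(** [ln_count_ge] with the box fixed and [M = k.*2.+1] tending to infinity: the boundary term,
    divided by [M], vanishes. *)
Lemma independence_le_entropy (R : realType) (A : finType) (X : set (int -> A))
    (d n : nat) (h : R) : subshift X -> X !=set0 ->
  (forall n, h <= max_block X R n.*2.+1 / n.*2.+1%:R) ->
  h <= ln (language_count (axial_power X d) (box d n))%:R / (n.*2.+1 ^ d)%:R.
Proof.
move=> X_subshift X0 hle.
set u := _ / _; pose a : R := (d * n)%:R * ln #|A|%:R.
have B0 : 0 < (n.*2.+1 ^ d)%:R :> R by rewrite ltr0n expn_gt0.
have key k : k.*2.+1%:R * (h - u) <= a.
  have k0 : 0 < k.*2.+1%:R :> R by rewrite ltr0n.
  have := ln_count_ge R X_subshift X0 d n k.*2.+1; rewrite -/a.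
  rewrite -ler_pdivlMl // mulrCA [_^-1 * _]mulrC -/u.
  by have := hle k; rewrite ler_pdivlMr //; lra.
rewrite leNgt; apply/negP => uh.
have := key (Num.truncn (a / (h - u))).+1; apply/negP; rewrite -ltNge.
rewrite -ltr_pdivrMr ?subr_gt0 //; apply: lt_le_trans (truncnS_gt _) _.
by rewrite ler_nat; case: (Num.truncn _) => [|t]; lia.
Qed.

Lemma entropies_empty (R : realType) (A : finType) :
  limiting_entropy R (set0 : set (int -> A)) = -oo%E /\
  independence_entropy R (set0 : set (int -> A)) = -oo%E.
Proof.
split.
  (* In dimension [0] there are no lines and the axial power is everything, so the constant value
     starts at [d = 1]. *)
  apply: lim_near_cst => //; exists 1%N => // d /= d0.
  apply: lim_near_cst => //; apply: nearW => n.
  have -> : language (axial_power set0 d) (box d n) = set0 :> set {ffun _ -> A}.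
    rewrite -subset0 => w [y Yy _]; exact: (Yy 0 (Ordinal d0)).
  rewrite fset_set0 cardfs0 /lne lexx mulrNy gtr0_sg ?mul1e // invr_gt0 ltr0n.
  by rewrite card_box expn_gt0.
apply: lim_near_cst => //; apply: nearW => n.
have -> : multi_choice (set0 : set (int -> A)) = set0.
  rewrite -subset0 => xh Xxh; have [x] := compatible_ex xh; exact: Xxh.
by rewrite /language image_set0 image_set0 ereal_sup0.
Qed.

Theorem theorem1p1 (R : realType) (A : finType) (X : set (int -> A)) :
  subshift X -> limiting_entropy R X = independence_entropy R X.
Proof.
move=> X_subshift; have [->|/set0P X0] := eqVneq X set0.
  by have [-> ->] := entropies_empty R A.
have [h -> [hcvg hle]] := independence_entropyE R X_subshift X0.
have /choice[e eP] d : exists r : R, entropy R (axial_power X d) = r%:E /\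
    (h <= r /\ forall n, r <= ln (language_count (axial_power X d) (box d n))%:R
       / (n.*2.+1 ^ d)%:R).
  have [r rE [rcvg rle]] := entropyE R X_subshift d X0; exists r; split => //.
  split=> //; apply: (cvgr_to_ge rcvg).
  by apply: nearW => n; apply: independence_le_entropy.
apply: (@limn_EFin _ e) => [d|]; first exact: (eP d).1.
apply/cvgrPdistC_le => eps eps0.
have eps2 : 0 < eps / 2 by rewrite divr_gt0.
move/cvgrPdistC_le : hcvg => /(_ _ eps2)[n _ /(_ n (leqnn n))].
rewrite /= ler_distl => /andP[_ hn].
have [D DP] := ln_count_le X_subshift X0 (ltn0Sn n.*2) eps2.
exists D => // d /= Dd; have [N NP] := DP d Dd.
(* The entropy is at most its ratio on any single box, so the one good box [N] suffices in each
   dimension. *)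
have [_ [hd dle]] := eP d; rewrite ger0_norm ?subr_ge0 //.
rewrite lerBlDr; apply: le_trans (dle N) _.
rewrite ler_pdivrMr ?ltr0n ?expn_gt0 // mulrC; apply: le_trans NP _.
by rewrite ler_wpM2l // [eps in leRHS]splitr [leRHS]addrAC lerD2r addrC.
Qed.
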